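(* Let $n>1$, $p$ an odd prime with $p>n$, $q=p^a$, $t\in\mathbb{F}_q^*$. For $0\le i\le 2n$, $\mathrm{ord}_pA(\varepsilon_{g(i)},\varepsilon_i)=\frac{g(i)}n$. For $0\le i\le n$ and $0\le j\le n-1$, $\mathrm{ord}_pA(\varepsilon_j,\varepsilon_i)=\frac jn+\frac{(2n+1)\alpha_{i,j}}{n(p-1)}$.
   Context: $\mathrm{ord}_p(p)=1$. Let $\gamma\in\mathbb{C}_p$ be a root of $\sum_{k\ge0}x^{p^k}/p^k$ with $\mathrm{ord}_p\gamma=\frac1{p-1}$, fix $\widetilde\gamma$ with $\widetilde\gamma^n=\gamma$, and $\Theta(x)=\exp(\sum_{k\ge0}(\gamma x)^{p^k}/p^k)$. Let $\bar t\in\mathbb{Z}_q$ be the Teichmüller lift of $t$ and define $B(a,b)$ by $\Theta(x^n)\Theta(y)\Theta(\bar t/(xy))=\sum B(a,b)x^ay^b$. $\sigma$ is the Frobenius of $\mathbb{Q}_q/\mathbb{Q}_p$ extended fixing $\zeta_p,\widetilde\gamma$. Weight $\omega(a,b)=\frac an+b+\frac{2n+1}n\max\{0,-a,-b\}$. For lattice points, $A((c,d),(a,b))=\sigma^{-1}(B(pc-a,pd-b))\widetilde\gamma^{n\omega(a,b)-n\omega(c,d)}$ (matrix coefficient of Dwork's Frobenius $\sigma^{-1}\circ\psi_p\circ F_t$ with respect to $\widetilde\gamma^{n\omega(a,b)}x^ay^b$). $\varepsilon_i=(i,0)$ (i.e. $x^i$) for $0\le i\le n$, $\varepsilon_i=(i-n,1)$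 (i.e. $x^{i-n}y$) for $n+1\le i\le 2n$. $\alpha_{i,j}=i-pj+n\lceil\frac{pj-i}n\rceil$. With $0<\varpi<n$ such that $p\varpi\equiv1\pmod n$: $g(i)=i$ for $i\in\{0,n,2n\}$, $g(i)=\varpi i+n\lceil\frac{-\varpi i}n\rceil$ for $1\le i\le n-1$, $g(i)=n+\varpi i+n\lceil\frac{-\varpi i}n\rceil$ for $n+1\le i\le 2n-1$.
   Formalization: The second formula is proved for all 0≤i≤n, 0≤j≤n-1 except (i,j)=(n,0), where it is false: there α_{n,0}=0, so it claims order 0, but A(ε_0,ε_n) has order (2n+1)/(p-1). *)

(* Defs.v *)
From HB Require Import structures.
From mathcomp Require Import all_boot all_order all_algebra.
From mathcomp Require Import all_classical constructive_ereal.
Set Implicit Arguments.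
Unset Strict Implicit.
Unset Printing Implicit Defensive.
Import Order.TTheory GRing.Theory Num.Theory.
Local Open Scope classical_set_scope.
Local Open Scope ring_scope.

(* The libraries contain no p-adic fields. C_p is described by a list of axioms
   that determines it up to valuation-preserving isomorphism; its additive
   valuation is rational-valued, with ord 0 = +oo. *)

Section Valuation.
Context {C : fieldType} (ord : C -> \bar rat).

Definition converges_to (u : nat -> C) (l : C) :=
  forall M : rat, exists N : nat, forall i : nat,
    (N <= i)%N -> (M%:E <= ord (u i - l))%E.

Definition is_cauchy (u : nat -> C) :=
  forall M : rat, exists N : nat, forall i j : nat,
    (N <= i)%N -> (N <= j)%N -> (M%:E <= ord (u i - u j))%E.

(* Q_p, as the closure of the prime field. *)
Definition Qp_of : set C :=
  [set x | forall M : rat, exists r : rat, (M%:E <= ord (x - ratr r))%E].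

Definition algebraic_over (k : set C) (y : C) :=
  exists P : {poly C}, [/\ P != 0, forall i, k P`_i & root P y].

End Valuation.

Record padic_complex (p : nat) := PadicComplex {
  Cp_field :> closedFieldType;
  ord : Cp_field -> \bar rat;
  ord_eq_pinfty : forall x, ord x = +oo%E <-> x = 0;
  ordM : forall x y, ord (x * y) = (ord x + ord y)%E;
  ordD : forall x y, (Order.min (ord x) (ord y) <= ord (x + y))%E;
  ord_p : ord p%:R = 1%:E;
  Cp_complete : forall u : nat -> Cp_field,
    is_cauchy ord u -> exists l, converges_to ord u l;
  Cp_dense : forall (x : Cp_field) (M : rat),
    exists2 y, algebraic_over (Qp_of ord) y & (M%:E <= ord (x - y))%E
}.

Section Fields.
Context {p : nat} {C : padic_complex p}.

Definition Qp : set C := Qp_of (@ord p C).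

Definition field_gen (S : set C) : set C :=
  smallest (fun k : set C => GRing.divring_closed (mem k)) S.

(* The unramified extension of Q_p of degree f, where q = p ^ f:
   it is generated by the (q-1)-th roots of unity. *)
Definition Qq (q : nat) : set C :=
  field_gen (Qp `|` [set x | x ^+ q.-1 = 1]).

Definition Zq (q : nat) : set C := [set x | Qq q x /\ (0 <= ord x)%E].

(* red identifies the residue field of Z_q with F; it is only relevant on
   Z_q. *)
Definition is_reduction (q : nat) (F : fieldType) (red : C -> F) :=
  [/\ red 1 = 1,
      forall x y, Zq q x -> Zq q y -> red (x + y) = red x + red y,
      forall x y, Zq q x -> Zq q y -> red (x * y) = red x * red y,
      forall x, Zq q x -> (red x = 0 <-> (0 < ord x)%E)
    & set_surj (Zq q) setT red].

Definition is_teichmuller (q : nat) (F : fieldType) (red : C -> F)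
    (t : F) (tbar : C) :=
  [/\ Zq q tbar, tbar ^+ q = tbar & red tbar = t].

(* The field Q_q(zeta_p, gammat). *)
Definition Kfield (q : nat) (zeta gammat : C) : set C :=
  field_gen (Qq q `|` [set zeta; gammat]).

(* sigma is only relevant on K. *)
Definition is_frobenius (q : nat) (zeta gammat : C) (sigma : C -> C) :=
  let K := Kfield q zeta gammat in
  [/\ [/\ set_bij K K sigma,
      forall x y, K x -> K y -> sigma (x + y) = sigma x + sigma y
    & forall x y, K x -> K y -> sigma (x * y) = sigma x * sigma y],
      [/\ forall x, Qp x -> sigma x = x,
      set_bij (Qq q) (Qq q) sigma
    & forall x, Zq q x -> (0 < ord (sigma x - x ^+ p))%E],
      sigma zeta = zeta
    & sigma gammat = gammat].

Definition is_gamma (gamma : C) :=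
  converges_to (@ord p C)
    (fun N => \sum_(k < N) gamma ^+ (p ^ k) / (p ^ k)%:R) 0
  /\ ord gamma = ((p.-1)%:R^-1 : rat)%:E.

(* Junk value 0 when the sequence diverges. *)
Definition plim (u : nat -> C) : C := xget 0 [set l | converges_to (@ord p C) u l].

(* The formal power series sum_m (f m) x^m is represented by f : nat -> C.
   For f 0 = 0, the m-th coefficient of exp f only involves the powers
   f^l, l <= m, of the truncation of f at degree m. *)
Definition exp_series (f : nat -> C) (m : nat) : C :=
  (\sum_(l < m.+1) (l`!%:R)^-1 *: (\poly_(i < m.+1) f i) ^+ l)`_m.

(* Coefficients of sum_k (gamma x)^(p^k) / p^k. The bound on k loses nothing,
   since k < p^k. *)
Definition AH_exponent (gamma : C) (m : nat) : C :=
  \sum_(k < m.+1 | (m == p ^ k)%N) gamma ^+ (p ^ k) / (p ^ k)%:R.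

Definition Theta (gamma : C) : nat -> C := exp_series (AH_exponent gamma).

(* Coefficient of x^a y^b in Theta(x^n) Theta(y) Theta(tbar/(xy)): the monomial
   (x^n)^l y^m (xy)^(-k) is x^(n l - k) y^(m - k). *)
Definition B (n : nat) (gamma tbar : C) (a b : int) : C :=
  plim (fun N => \sum_(l < N) \sum_(m < N)
    \sum_(k < N | (n%:Z * l%:Z - k%:Z == a) && (m%:Z - k%:Z == b))
      Theta gamma l * Theta gamma m * (Theta gamma k * tbar ^+ k)).

Definition omega (n : nat) (u : int * int) : rat :=
  let: (a, b) := u in
  a%:Q / n%:R + b%:Q
  + (2 * n + 1)%:R / n%:R * Num.max 0 (Num.max (- a%:Q) (- b%:Q)).

(* n * omega is integer-valued, so that Num.floor is a mere cast to int. *)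
Definition nomega (n : nat) (u : int * int) : int :=
  Num.floor (n%:R * omega n u).

Lemma nomegaE (n : nat) (u : int * int) : (0 < n)%N ->
  (nomega n u)%:Q = n%:R * omega n u.
Proof.
move=> n0; rewrite /nomega; case: u => a b.
have nn0 : n%:R != 0 :> rat by rewrite pnatr_eq0 -lt0n.
suff -> : n%:R * omega n (a, b) =
    (a + n%:Z * b + (2 * n + 1)%:Z * Num.max 0 (Num.max (- a) (- b)))%:~R.
  by rewrite intrKfloor.
have maxE (x y : int) : (Num.max x y)%:Q = Num.max x%:Q y%:Q.
  by rewrite !maxEle ler_int; case: ifP.
rewrite /omega; move: (2 * n + 1)%N => m.
rewrite !rmorphD !rmorphM /= !maxE !mulrNz mulr0z !mulrDr.
by rewrite mulrCA divff // mulr1 mulrA mulrCA divff // mulr1.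
Qed.

Definition A (n q : nat) (gamma zeta gammat tbar : C) (sigma : C -> C)
    (v u : int * int) : C :=
  'pinv_id (Kfield q zeta gammat) sigma
    (B n gamma tbar (p%:Z * v.1 - u.1) (p%:Z * v.2 - u.2))
  * gammat ^ (nomega n u - nomega n v).

End Fields.

Definition eps (n : nat) (i : int) : int * int :=
  if i <= n%:Z then (i, 0) else (i - n%:Z, 1).

Definition alpha (p n i j : nat) : int :=
  i%:Z - p%:Z * j%:Z
  + n%:Z * Num.ceil ((p%:Z * j%:Z - i%:Z)%:Q / n%:R).

Definition g (n varpi i : nat) : int :=
  let r := varpi%:Z * i%:Z
           + n%:Z * Num.ceil ((- (varpi%:Z * i%:Z))%:Q / n%:R) in
  if i \in [:: 0%N; n; (2 * n)%N] then i%:Z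
  else if (i < n)%N then r else n%:Z + r.

(* Main.v *)
From HB Require Import structures.
Require Import Defs.
From mathcomp Require Import all_boot all_order all_algebra.
From mathcomp Require Import all_classical constructive_ereal.
From mathcomp Require Import ring lra zify.
Set Implicit Arguments.
Unset Strict Implicit.
Unset Printing Implicit Defensive.
Import Order.TTheory GRing.Theory Num.Theory.
Local Open Scope ring_scope.

(* Write Theta_m = gamma^m e_m, where sum e_m x^m = exp(sum_k x^(p^k)/p^k) is the
   Artin-Hasse series. Its coefficients are p-integral rationals (Dwork), and
   units for m < p, so that ord Theta_m >= m/(p-1), with equality for m < p.

   The terms of B(a,b) are indexed by the (l,m,k) in N^3 such that n l - k = a
   and m - k = b. They lie on a half-line of direction (1,n,n), along which the
   lower bound (l+m+k)/(p-1) increases strictly; for the pairs (a,b) of the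
   theorem the first point has l, m, k < p, hence it determines ord B(a,b).

   To apply sigma^-1, note that gamma^(p-1) is in Q_p, so that B(a,b) is a
   polynomial in gamma and tbar with coefficients in Q_p. Therefore
   sigma^-1(B(a,b)) is the same expression with tbar replaced by another root of
   unity tau, and its order is given by the same computation. *)

(** * The valuation *)

Section OrdTheory.
Context {p : nat} {C : padic_complex p}.
Implicit Types (x y z : C) (r s : rat).

Lemma ord_0 : ord (0 : C) = +oo%E.
Proof. exact/ord_eq_pinfty. Qed.

(** Cancelling the finite value [ord_p] in p * 1 = p also rules out an infinite order. *)
Lemma ord_1 : ord (1 : C) = 0%E.
Proof.
have h : ord (p%:R * 1 : C) = 1%:E by rewrite mulr1 ord_p.
rewrite ordM ord_p in h.
move: h; case: (ord (1 : C)) => [r| |] //= [] h.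
by congr (_%:E); lra.
Qed.

(** An infinite order of x would make ord x + ord x^-1 infinite, whereas this sum is ord 1 = 0. *)
Lemma ord_fin x : x != 0 -> exists r, ord x = r%:E.
Proof.
move=> x0; have := ordM x x^-1; rewrite mulfV // ord_1.
case: (ord x) => [r| |]; first by exists r.
- by case: (ord x^-1).
- by case: (ord x^-1).
Qed.

Lemma ord_neq0 x r : ord x = r%:E -> x != 0.
Proof. by move=> xr; apply/eqP => x0; move: xr; rewrite x0 ord_0. Qed.

Lemma ordM_fin x y r s : ord x = r%:E -> ord y = s%:E -> ord (x * y) = (r + s)%:E.
Proof. by move=> xr ys; rewrite ordM xr ys. Qed.

Lemma ordX_fin x r n : ord x = r%:E -> ord (x ^+ n) = (r * n%:R)%:E.
Proof.
move=> xr; elim: n => [|n IH]; first by rewrite expr0 ord_1 mulr0.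
by rewrite exprS (ordM_fin xr IH); congr (_%:E); rewrite -natr1; lra.
Qed.

Lemma ordV_fin x r : ord x = r%:E -> ord x^-1 = (- r)%:E.
Proof.
move=> xr; have x0 := ord_neq0 xr.
have [s xs] : exists s, ord x^-1 = s%:E by apply: ord_fin; rewrite invr_eq0.
have := ordM_fin xr xs; rewrite mulfV // ord_1 xs => -[] h.
by congr (_%:E); lra.
Qed.

Lemma ordXz_fin x r (n : int) : ord x = r%:E -> ord (x ^ n) = (r * n%:Q)%:E.
Proof.
move=> xr; case: n => n; first by rewrite -exprnP (ordX_fin _ xr).
rewrite NegzE -exprnN; have := ordV_fin (ordX_fin n.+1 xr) => ->.
by congr (_%:E); rewrite mulrNz mulrN.
Qed.

Lemma ord_of_exp x r n : (0 < n)%N -> ord (x ^+ n) = r%:E -> ord x = (r / n%:R)%:E.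
Proof.
move=> n0 xr; have [s xs] : exists s, ord x = s%:E.
  apply: ord_fin; apply/eqP => x0.
  by move: xr; rewrite x0 expr0n -[n == 0%N]negbK -lt0n n0 ord_0.
have := ordX_fin n xs; rewrite xr xs => -[] ->.
by rewrite mulfK // pnatr_eq0 -lt0n.
Qed.

(** Estimates are phrased as rational lower bounds, so that 0, of order +oo, needs no separate
    case. *)
Definition ord_ge r x : bool := (r%:E <= ord x)%E.

Lemma ord_ge_fin r s x : ord x = s%:E -> ord_ge r x = (r <= s).
Proof. by move=> xs; rewrite /ord_ge xs lee_fin. Qed.

Lemma ord_ge0 r : ord_ge r 0.
Proof. by rewrite /ord_ge ord_0 leey. Qed.

Lemma ord_geW r s x : s <= r -> ord_ge r x -> ord_ge s x.
Proof. by move=> sr; apply: le_trans; rewrite lee_fin. Qed.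

Lemma ord_geD r x y : ord_ge r x -> ord_ge r y -> ord_ge r (x + y).
Proof.
move=> xr yr; apply: le_trans (ordD x y).
by rewrite le_min; apply/andP; split.
Qed.

Lemma ord_geM r s x y : ord_ge r x -> ord_ge s y -> ord_ge (r + s) (x * y).
Proof. by move=> xr ys; rewrite /ord_ge ordM EFinD; apply: leeD. Qed.

Lemma ord_ge_exp r x n : ord_ge r x -> ord_ge (r * n%:R) (x ^+ n).
Proof.
move=> xr; elim: n => [|n IH]; first by rewrite /ord_ge ord_1 mulr0.
rewrite exprS -natr1 mulrDr mulr1 addrC; exact: ord_geM.
Qed.

Lemma ordN1 : ord (-1 : C) = 0%E.
Proof.
have h : ord ((-1 : C) ^+ 2) = 0%:E by rewrite sqrrN expr1n ord_1.
by rewrite (ord_of_exp _ h) // mul0r.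
Qed.

Lemma ordN x : ord (- x) = ord x.
Proof. by rewrite -mulN1r ordM ordN1 add0e. Qed.

Lemma ord_geN r x : ord_ge r (- x) = ord_ge r x.
Proof. by rewrite /ord_ge ordN. Qed.

Lemma ord_geB r x y : ord_ge r x -> ord_ge r y -> ord_ge r (x - y).
Proof. by move=> xr yr; apply: ord_geD; rewrite ?ord_geN. Qed.

Lemma ord_ge_sum r (I : Type) (s : seq I) (P : pred I) (F : I -> C) :
  (forall i, P i -> ord_ge r (F i)) -> ord_ge r (\sum_(i <- s | P i) F i).
Proof.
by move=> h; elim/big_rec: _ => [|i x Pi xr]; [exact: ord_ge0|apply: ord_geD; auto].
Qed.

Lemma ord_ge_natr n : ord_ge 0 n%:R.
Proof.
elim: n => [|n IH]; first exact: ord_ge0.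
by rewrite -natr1; apply: ord_geD => //; rewrite /ord_ge ord_1.
Qed.

Lemma ord_ge_sub r x y : ord_ge r (x - y) -> ord_ge r y -> ord_ge r x.
Proof. by move=> xy yr; rewrite -[x](subrK y); apply: ord_geD. Qed.

(** If ord y exceeded r, then x = y - (y - x) would have order at least min(ord y, s) > r. *)
Lemma ord_perturb r s x y : ord x = r%:E -> ord_ge s (y - x) -> r < s -> ord y = r%:E.
Proof.
move=> xr yxs rs; have [y0|y0] := eqVneq y 0.
  by move: yxs; rewrite y0 sub0r ord_geN (ord_ge_fin _ xr) leNgt rs.
have [u yu] := ord_fin y0; rewrite yu; congr (_%:E).
have : ord_ge r y.
  by apply: ord_ge_sub (ord_geW (ltW rs) yxs) _; rewrite (ord_ge_fin _ xr).
rewrite (ord_ge_fin _ yu) => ru; apply/eqP; rewrite eq_le ru andbT leNgt.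
apply/negP => ru'.
have [m [rm mu ms]] : exists m, [/\ r < m, m <= u & m <= s].
  by exists (Num.min u s); rewrite lt_min ru' rs !ge_min !lexx orbT.
have : ord_ge m x.
  rewrite -[x](subKr y); apply: ord_geB; last exact: ord_geW yxs.
  by rewrite (ord_ge_fin _ yu).
by rewrite (ord_ge_fin _ xr); lra.
Qed.

Lemma ord_ge_all_eq0 x : (forall r, ord_ge r x) -> x = 0.
Proof.
move=> h; apply/eqP; apply/negP => /negP /ord_fin[r xr].
by have := h (r + 1); rewrite (ord_ge_fin _ xr); lra.
Qed.

Lemma ord_natX_p k : ord ((p ^ k)%:R : C) = k%:R%:E.
Proof. by rewrite natrX (ordX_fin _ (ord_p C)) mul1r. Qed.

Section Prime.
Hypothesis p_prime : prime p.

(** Bezout writes 1 as a combination of m and p; a positive order of m would give 1 a positive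
    order. *)
Lemma ord_natr_coprime m : coprime p m -> ord (m%:R : C) = 0%E.
Proof.
move=> co; have m0 : (0 < m)%N.
  case: m co => //; rewrite /coprime gcdn0 => /eqP p1.
  by have := prime_gt1 p_prime; rewrite p1.
have small s : 0 < s -> s <= 1 -> ~~ ord_ge s (m%:R : C).
  move=> s0 s1; apply/negP => sm.
  have : ord_ge s (1 : C); last by rewrite (ord_ge_fin _ ord_1) leNgt s0.
  case: (egcdnP p m0) => km kn e _.
  rewrite gcdnC (eqP co) in e.
  have -> : (1 : C) = km%:R * m%:R - kn%:R * p%:R.
    by rewrite -!natrM e natrD; ring.
  apply: ord_geB; rewrite -[s]add0r; apply: ord_geM; try exact: ord_ge_natr.
    by [].
  by rewrite (ord_ge_fin _ (ord_p C)).
have [mr0|mn0] := eqVneq (m%:R : C) 0.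
  by have := small 1 ltr01 (lexx _); rewrite mr0 ord_ge0.
have [r mr] := ord_fin mn0; rewrite mr; congr (_%:E).
have := ord_ge_natr m; rewrite (ord_ge_fin _ mr) => r0.
apply/eqP; rewrite eq_le r0 andbT leNgt; apply/negP => rgt0.
have := small (Num.min r 1); rewrite lt_min rgt0 ltr01 ge_min lexx orbT.
by rewrite (ord_ge_fin _ mr) ge_min lexx => /(_ isT isT).
Qed.

Lemma ord_natr m : (0 < m)%N -> ord (m%:R : C) = (logn p m)%:R%:E.
Proof.
move=> m0.
have [m' co mE] := pfactor_coprime p_prime m0.
rewrite {1}mE mulnC natrM.
by rewrite (ordM_fin (ord_natX_p _) (ord_natr_coprime co)) addr0.
Qed.

End Prime.
End OrdTheory.

(** * Truncated power series *)

Section TruncatedSeries.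
Context {K : fieldType}.
Implicit Types P Q R T : {poly K}.

(** Congruence modulo X^N: polynomials stand for truncated power series. *)
Definition eqX N P Q := forall i, (i < N)%N -> P`_i = Q`_i.

Lemma eqX_eq N P Q : P = Q -> eqX N P Q.
Proof. by move->. Qed.

Lemma eqX_trans N P Q R : eqX N P Q -> eqX N Q R -> eqX N P R.
Proof. by move=> h h' i iN; rewrite h // h'. Qed.

Lemma eqXD N P Q R T : eqX N P Q -> eqX N R T -> eqX N (P + R) (Q + T).
Proof. by move=> h h' i iN; rewrite !coefD h // h'. Qed.

Lemma eqXM N P Q R T : eqX N P Q -> eqX N R T -> eqX N (P * R) (Q * T).
Proof.
move=> h h' i iN; rewrite !coefM; apply: eq_bigr => j _.
rewrite h ?h' //; first by apply: leq_ltn_trans iN; rewrite leq_subr.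
by apply: leq_ltn_trans iN; rewrite -ltnS.
Qed.

Lemma eqXMl N P Q R : eqX N P Q -> eqX N (R * P) (R * Q).
Proof. exact: eqXM. Qed.

Lemma eqX_exp N P Q l : eqX N P Q -> eqX N (P ^+ l) (Q ^+ l).
Proof. by move=> h; elim: l => [//|l IH]; rewrite !exprS; apply: eqXM. Qed.

Lemma eqX_comp_Xn N P Q k : (0 < k)%N -> eqX N P Q ->
  eqX N (P \Po 'X^k) (Q \Po 'X^k).
Proof.
move=> k0 h i iN; rewrite !coef_comp_poly_Xn //; case: ifP => // _.
by apply: h; apply: leq_ltn_trans iN; rewrite leq_div.
Qed.

(** The Euler operator x d/dx. Unlike d/dx it preserves degrees, so no precision is lost modulo
    X^N. *)
Definition theta P := 'X * P^`().

Lemma coef_theta P i : (theta P)`_i = i%:R * P`_i.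
Proof.
rewrite coefXM; case: i => [|i] /=; first by rewrite mul0r.
by rewrite coef_deriv mulr_natl.
Qed.

Lemma thetaM P Q : theta (P * Q) = theta P * Q + P * theta Q.
Proof. by rewrite /theta derivM; ring. Qed.

Lemma theta_exp P n : theta (P ^+ n) = n%:R * P ^+ n.-1 * theta P.
Proof. by rewrite /theta deriv_exp -mulr_natl; ring. Qed.

Lemma theta_comp_Xn P k : (0 < k)%N ->
  theta (P \Po 'X^k) = k%:R * (theta P \Po 'X^k).
Proof.
move=> k0; rewrite /theta deriv_comp derivXn comp_polyM comp_polyX.
have <- : ('X : {poly K}) * 'X^(k.-1) = 'X^k by rewrite -exprS prednK.
by rewrite -mulr_natl; ring.
Qed.

Lemma coef_exp_small P l m : P`_0 = 0 -> (m < l)%N -> (P ^+ l)`_m = 0.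
Proof.
move=> P0 ml; have -> : P = 'X * \poly_(i < size P) P`_i.+1.
  apply/polyP => -[|i]; rewrite coefXM //= coef_poly; case: ltnP => // si.
  by rewrite nth_default // leqW.
by rewrite exprMn coefXnM ml.
Qed.

Lemma coef0M P Q : (P * Q)`_0 = P`_0 * Q`_0.
Proof. by rewrite coefM big_ord_recl big_ord0 addr0. Qed.

Lemma coef0_exp P n : (P ^+ n)`_0 = P`_0 ^+ n.
Proof.
elim: n => [|n IH]; first by rewrite !expr0 coefC.
by rewrite !exprS coef0M IH.
Qed.

(** The square of c X^M vanishes modulo X^(M+1), so only the linear term n P^(n-1) c X^M of the
    binomial expansion contributes, and P^(n-1) has constant term 1. *)
Lemma coef_expD_top P c M n : P`_0 = 1 -> (0 < M)%N ->
  ((P + c *: 'X^M) ^+ n)`_M = (P ^+ n)`_M + n%:R * c.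
Proof.
move=> P0 M0; set D := c *: 'X^M.
have D2 R : eqX M.+1 (R + D * D) R.
  move=> i iM; rewrite coefD /D -scalerAl -scalerAr -exprD !coefZ coefXn.
  by rewrite ltn_eqF ?mulr0 ?addr0 //; lia.
have exp_mod : eqX M.+1 ((P + D) ^+ n) (P ^+ n + n%:R * P ^+ n.-1 * D).
  elim: n => [|n IH]; first by apply: eqX_eq; rewrite !expr0 !mul0r addr0.
  rewrite exprS; apply: eqX_trans (eqXMl _ IH) _.
  have Pn : P * (n%:R * P ^+ n.-1) = n%:R * P ^+ n.
    by case: (n) => [|k]; rewrite ?mul0r ?mulr0 //= exprS; ring.
  apply: (@eqX_trans _ _ (P ^+ n.+1 + n.+1%:R * P ^+ n * D +
                          n%:R * P ^+ n.-1 * (0 + D * D))).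
    apply: eqX_eq; rewrite -[n.+1%:R]natr1 exprS mulrDl mulrDr mulrA Pn; ring.
  apply: eqX_trans (eqXD (eqX_eq (erefl _)) (eqXMl _ (D2 0))) _.
  by apply: eqX_eq; rewrite mulr0 addr0.
rewrite exp_mod // coefD /D -scalerAr coefZ coefMXn ltnn subnn coef0M coef0_exp.
by rewrite P0 expr1n mulr1 -polyC_natr coefC mulrC.
Qed.

Definition exp_poly N P := \sum_(l < N.+1) (l`!%:R : K)^-1 *: P ^+ l.

Lemma coef_exp_polyZX N c i : (i <= N)%N ->
  (exp_poly N (c *: 'X))`_i = (i`!%:R)^-1 * c ^+ i.
Proof.
move=> iN; rewrite coef_sum (bigD1 (Ordinal (iN : (i < N.+1)%N))) //= big1.
  by rewrite addr0 exprZn !coefZ coefXn eqxx mulr1.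
move=> j ji; rewrite exprZn !coefZ coefXn.
rewrite (_ : (i == j) = false) ?mulr0 //.
by apply: contraNF ji => /eqP ij; apply/eqP/val_inj.
Qed.

Section Char0.
Hypothesis char0 : forall m, m.+1%:R != 0 :> K.

(** The two sides differ by P^N theta(P) / N!, which starts in degree N+1 because neither P nor
    theta(P) has a constant term. *)
Lemma theta_exp_poly N P : P`_0 = 0 ->
  eqX N.+1 (theta (exp_poly N P)) (exp_poly N P * theta P).
Proof.
move=> P0.
have fact0 m : (m`!%:R : K) != 0.
  by have := fact_gt0 m; case: (m`!)%N => // k _; apply: char0.
have deriv_exp_poly : (exp_poly N P)^`() =
    \sum_(l < N) (l`!%:R : K)^-1 *: (P ^+ l * P^`()).
  rewrite /exp_poly big_ord_recl expr0 derivD derivZ derivC scaler0 add0r.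
  rewrite raddf_sum /=; apply: eq_bigr => l _.
  rewrite derivZ deriv_exp /bump add1n /= factS natrM invfM.
  rewrite -scaler_nat scalerA mulrAC mulVf ?char0 // mul1r.
  by rewrite mulrC.
have -> : theta (exp_poly N P) =
    exp_poly N P * theta P - (N`!%:R : K)^-1 *: (P ^+ N * theta P).
  rewrite /theta deriv_exp_poly /exp_poly big_ord_recr /= mulrDl -scalerAl addrK.
  rewrite mulr_sumr mulr_suml; apply: eq_bigr => l _.
  by rewrite -scalerAl -scalerAr; congr (_ *: _); ring.
move=> i iN; rewrite coefB coefZ (_ : (P ^+ N * theta P)`_i = 0) ?mulr0 ?subr0 //.
rewrite coefM big1 // => j _.
have [jN|jN] := ltnP j N; first by rewrite coef_exp_small ?mul0r.
rewrite coef_theta (_ : (i - j = 0)%N) ?mul0r ?mulr0 //.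
by apply/eqP; rewrite subn_eq0; apply: leq_trans jN.
Qed.

(** Since T has no constant term, i P_i is determined by the P_j with j < i; characteristic 0 allows
    division by i. *)
Lemma theta_uniq N P Q T : T`_0 = 0 -> P`_0 = Q`_0 ->
  eqX N (theta P) (P * T) -> eqX N (theta Q) (Q * T) -> eqX N P Q.
Proof.
move=> T0 PQ0 hP hQ i; elim/ltn_ind: i => -[//|i] IH iN.
apply: (mulfI (char0 i)); rewrite -!coef_theta hP // hQ // !coefM.
apply: eq_bigr => j _; have [ji|ij] := ltnP j i.+1.
  by rewrite IH //; apply: ltn_trans iN.
by rewrite (_ : (i.+1 - j = 0)%N) ?T0 ?mulr0 //; apply/eqP; rewrite subn_eq0.
Qed.

(** * Dwork's identity *)

Section Dwork.
Variable p : nat.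
Hypothesis p_prime : prime p.

Lemma pnat_prime_rec j : p.-nat j = (j == 1%N) || (p %| j)%N && p.-nat (j %/ p)%N.
Proof.
have p0 := prime_gt0 p_prime.
apply/idP/idP => [/p_natP[[|k] ->] //|/orP[/eqP -> //|/andP[pj]]].
  by rewrite expnS dvdn_mulr // mulKn // pnatX pnat_id // orbT.
by move=> h; rewrite -(divnK pj) pnatM h pnat_id.
Qed.

(** For p prime, [p.-nat j] means that j is a power of p: this is the truncation of sum_k x^(p^k),
    the Euler derivative of sum_k x^(p^k)/p^k. *)
Let S N : {poly K} := \poly_(j < N) (p.-nat j)%:R.

(** Substituting x^p turns x^(p^k) into x^(p^(k+1)), so only the term k = 0 is lost. *)
Lemma pnat_series_comp N : eqX N (S N \Po 'X^p + 'X) (S N).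
Proof.
move=> j jN; rewrite coefD coef_comp_poly_Xn ?prime_gt0 // coefX !coef_poly jN.
rewrite (leq_ltn_trans (leq_div _ _) jN) [in RHS]pnat_prime_rec.
have [-> /=|j1 /=] := eqVneq j 1%N.
  by rewrite dvdn1 (gtn_eqF (prime_gt1 p_prime)) add0r.
by rewrite addr0; case: (p %| j)%N.
Qed.

(* Dwork's identity E(x)^p = E(x^p) exp(p x) for E = exp(sum_k x^(p^k)/p^k):
   both sides have logarithmic derivative p * sum_k x^(p^k) (with respect to
   x d/dx). *)
Lemma dwork_identity (e : nat -> K) N : e 0%N = 1 ->
  (forall m, m%:R * e m = \sum_(i < m.+1) e i * (p.-nat (m - i)%N)%:R) ->
  let P := \poly_(i < N.+1) e i in
  eqX N.+1 (P ^+ p) ((P \Po 'X^p) * exp_poly N (p%:R *: 'X)).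
Proof.
move=> e0 rec P; have p0 := prime_gt0 p_prime.
set T := S N.+1; set G := exp_poly N _.
have P0 : P`_0 = 1 by rewrite coef_poly.
have thP : eqX N.+1 (theta P) (P * T).
  move=> i iN; rewrite coef_theta coef_poly iN rec coefM; apply: eq_bigr => j _.
  rewrite !coef_poly (leq_ltn_trans (leq_subr _ _) iN).
  by rewrite (leq_ltn_trans (leq_ord j) iN).
have T0 : T`_0 = 0 by rewrite coef_poly.
have natZ (Q : {poly K}) : p%:R *: Q = p%:R * Q by rewrite scaler_nat mulr_natl.
have G0 : G`_0 = 1 by rewrite coef_exp_polyZX // expr0 mulr1 invr1.
apply: (@theta_uniq _ _ _ (p%:R *: T)).
- by rewrite coefZ T0 mulr0.
- rewrite coef0M coef_comp_poly_Xn // dvdn0 div0n G0 mulr1.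
  by rewrite coef0_exp P0 expr1n.
- rewrite theta_exp.
  apply: eqX_trans (eqXMl _ thP) _.
  have <- : P * P ^+ p.-1 = P ^+ p by rewrite -exprS prednK.
  by rewrite natZ; apply: eqX_eq; ring.
- rewrite thetaM theta_comp_Xn //.
  have thG : eqX N.+1 (theta G) (G * (p%:R * 'X)).
    have -> : p%:R * 'X = theta (p%:R *: 'X) :> {poly K}.
      by rewrite /theta derivZ derivX natZ; ring.
    by apply: theta_exp_poly; rewrite coefZ coefX mulr0.
  have thPc : eqX N.+1 (theta P \Po 'X^p) ((P \Po 'X^p) * (T \Po 'X^p)).
    by rewrite -comp_polyM; apply: eqX_comp_Xn.
  apply: eqX_trans (eqXD (eqXM (eqXMl _ thPc) (eqX_eq (erefl G))) (eqXMl _ thG)) _.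
  apply: eqX_trans (_ : eqX _ ((P \Po 'X^p) * G * p%:R * (T \Po 'X^p + 'X)) _).
    by apply: eqX_eq; ring.
  have h := eqXMl ((P \Po 'X^p) * G * p%:R) (@pnat_series_comp N.+1).
  apply: eqX_trans h _.
  by apply: eqX_eq; rewrite natZ /T; ring.
Qed.

End Dwork.
End Char0.
End TruncatedSeries.

(** * Integral elements and rational numbers *)

(** In Legendre's formula each quotient is at most a third of the previous one because p >= 3, so
    the sum is at most n/2. The last quotient is kept in [bound] to make the induction go
    through. *)
Lemma logn_fact_lt p n : prime p -> (2 < p)%N -> (0 < n)%N -> (logn p n`! < n)%N.
Proof.
move=> p_prime p2 n0; rewrite logn_fact //.
have bound m : (2 * \sum_(1 <= k < m.+1) n %/ p ^ k + n %/ p ^ m <= n)%N.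
  elim: m => [|m IH]; first by rewrite big_geq // expn0 divn1.
  apply: leq_trans IH; rewrite big_nat_recr //= mulnDr -addnA leq_add2l.
  rewrite expnSr divnMA; set x := (n %/ p ^ m)%N.
  apply: leq_trans (leq_divM x p); rewrite addnC -mulSn mulnC.
  by rewrite leq_mul2l p2 orbT.
apply: leq_ltn_trans (_ : (n %/ 2 < n)%N); last by rewrite ltn_Pdiv.
by rewrite leq_divRL // mulnC; apply: leq_trans (bound n); rewrite leq_addr.
Qed.

(** The inner binomial coefficients are divisible by p. The subring S is a parameter, to be taken as
    the integers of C or the polynomials over them. *)
Lemma exprD_prime (R : comNzRingType) (S : subringClosed R) (p : nat) x y :
  prime p -> x \in S -> y \in S ->
  exists2 z, z \in S & (x + y) ^+ p = x ^+ p + y ^+ p + p%:R * z.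
Proof.
move=> p_prime xS yS; case: p p_prime => // p p_prime.
exists (\sum_(i < p) x ^+ (p - i) * y ^+ i.+1 *+ ('C(p.+1, i.+1) %/ p.+1)).
  by apply: rpred_sum => i _; rewrite rpredMn // rpredM ?rpredX.
rewrite exprDn big_ord_recl big_ord_recr /= subn0 expr0 mulr1 bin0 mulr1n.
rewrite /bump !leq0n !add1n subnn expr0 mul1r binn mulr1n addrAC addrA.
congr (_ + _ + _); rewrite mulr_sumr; apply: eq_bigr => i _.
rewrite leq0n add1n subSS mulr_natl -mulrnA divnK //.
by apply: prime_dvd_bin => //; rewrite ltn0Sn ltnS ltn_ord.
Qed.

Section IntegerRing.
Context {p : nat} {C : padic_complex p}.
Implicit Types (x y : C).

Definition Oring : {pred C} := [pred x | ord_ge 0 x].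

Lemma in_Oring x : (x \in Oring) = ord_ge 0 x. Proof. by []. Qed.

Fact Oring_subring : subring_closed Oring.
Proof.
split=> [|x y xO yO|x y xO yO]; rewrite in_Oring.
- by rewrite (ord_ge_fin _ ord_1).
- exact: ord_geB.
- by rewrite -[0]addr0; apply: ord_geM.
Qed.

HB.instance Definition _ := GRing.isSubringClosed.Build C Oring Oring_subring.

Hypothesis p_prime : prime p.

Lemma natrC_neq0 m : m.+1%:R != 0 :> C.
Proof. exact: ord_neq0 (ord_natr p_prime _). Qed.

Lemma intrC_eq0 (m : int) : (m%:~R == 0 :> C) = (m == 0).
Proof.
case: m => [[|m]|m]; first by rewrite !eqxx.
  by rewrite -pmulrn (negPf (natrC_neq0 m)).
by rewrite NegzE mulrNz oppr_eq0 -pmulrn (negPf (natrC_neq0 _)).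
Qed.

(** [ratr] is computed from the reduced fraction; independence of the representative is what makes
    it compatible with the field operations of C. *)
Lemma ratr_frac (a b : int) : b != 0 ->
  ratr (a%:Q / b%:Q) = a%:~R / b%:~R :> C.
Proof.
move=> b0; set r := a%:Q / b%:Q.
have e : numq r * b = a * denq r.
  apply: (@intr_inj rat); rewrite !rmorphM /= numqE /r.
  by rewrite mulrAC divfK ?intr_eq0.
rewrite /ratr; apply/eqP; rewrite eqr_div ?intrC_eq0 ?denq_neq0 //.
by rewrite -!intrM e.
Qed.

Lemma ratrC_0 : ratr 0 = 0 :> C. Proof. exact: (ratr_nat C 0). Qed.

Lemma ratrC_1 : ratr 1 = 1 :> C. Proof. exact: (ratr_nat C 1). Qed.

Lemma ratrC_D r s : ratr (r + s) = ratr r + ratr s :> C.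
Proof.
have e : r + s = (numq r * denq s + numq s * denq r)%:Q / (denq r * denq s)%:Q.
  rewrite -{1}[r]divq_num_den -{1}[s]divq_num_den addf_div ?intr_eq0 ?denq_neq0 //.
  by rewrite !(rmorphD, rmorphM).
rewrite e ratr_frac ?mulf_neq0 ?denq_neq0 // /ratr.
by rewrite addf_div ?intrC_eq0 ?denq_neq0 // !(rmorphD, rmorphM).
Qed.

Lemma ratrC_M r s : ratr (r * s) = ratr r * ratr s :> C.
Proof.
have e : r * s = (numq r * numq s)%:Q / (denq r * denq s)%:Q.
  by rewrite -{1}[r]divq_num_den -{1}[s]divq_num_den mulf_div !rmorphM.
rewrite e ratr_frac ?mulf_neq0 ?denq_neq0 // /ratr.
by rewrite mulf_div !rmorphM.
Qed.

Lemma ratrC_V r : ratr r^-1 = (ratr r)^-1 :> C.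
Proof.
have [->|r0] := eqVneq r 0; first by rewrite invr0 ratrC_0 invr0.
rewrite -{1}[r]divq_num_den invf_div ratr_frac ?numq_eq0 //.
by rewrite /ratr invf_div.
Qed.

(* The elements of Z_p satisfy this; it is what makes the Frobenius congruence
   P(x)^p = P(x^p) mod p available. *)
Definition fermat x := ord_ge 0 x /\ ord_ge 1 (x ^+ p - x).

Lemma p_divisibleP x : ord_ge 1 x <-> exists2 y, ord_ge 0 y & x = p%:R * y.
Proof.
have pp := ord_p C; split=> [x1|[y y0 ->]].
  exists (p%:R^-1 * x); last by rewrite mulVKf ?(ord_neq0 pp).
  rewrite -[0](addNr 1); apply: ord_geM => //.
  by rewrite (ord_ge_fin _ (ordV_fin pp)).
by rewrite -[1]addr0; apply: ord_geM => //; rewrite (ord_ge_fin _ pp).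
Qed.

(** By [exprD_prime] the property is stable under addition, so it spreads from 0, 1 and -1 to all
    integers. *)
Lemma fermat_int (m : int) : fermat (m%:~R : C).
Proof.
have ferD x y : fermat x -> fermat y -> fermat (x + y).
  move=> [x0 x1] [y0 y1]; split; first exact: ord_geD.
  have [z z0 ->] := exprD_prime p_prime (x0 : x \in Oring) (y0 : y \in Oring).
  rewrite (_ : _ - _ = (x ^+ p - x) + (y ^+ p - y) + p%:R * z); last by ring.
  by do 2?apply: ord_geD => //; apply/p_divisibleP; exists z.
have fer0 : fermat 0.
  by rewrite /fermat expr0n gtn_eqF ?prime_gt0 // subr0; split; exact: ord_ge0.
have fer1 : fermat 1.
  by split; rewrite ?expr1n ?subrr ?ord_ge0 // (ord_ge_fin _ ord_1).
have ferN1 : fermat (-1).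
  rewrite /fermat (_ : (-1) ^+ p - -1 = p%:R * (((-1) ^+ p + 1) / p%:R)); last first.
    by rewrite mulrC divfK ?(ord_neq0 (ord_p C)) // opprK.
  split; first by rewrite ord_geN (ord_ge_fin _ ord_1).
  apply/p_divisibleP; exists (((-1) ^+ p + 1) / p%:R) => //.
  (* The quotient ((-1)^p + 1) / p is 1 for p = 2 and 0 for p odd. *)
  case: (even_prime p_prime) => [p2|p_odd].
    by rewrite [X in _ ^+ X]p2 sqrrN expr1n -[1 + 1]/(2%:R) -p2 divff
      ?(ord_neq0 (ord_p C)) // (ord_ge_fin _ ord_1).
  by rewrite -signr_odd p_odd expr1 addNr mul0r ord_ge0.
case: m => m; last rewrite NegzE.
  by elim: m => [//|m IH]; rewrite -addn1 PoszD rmorphD; apply: ferD.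
elim: m => [//|m IH]; rewrite -addn1 PoszD opprD rmorphD; exact: ferD.
Qed.

(** Integrality forces the reduced denominator b to be prime to p, and then (a/b)^p - a/b = ((a^p -
    a) b - a (b^p - b)) / b^(p+1) reduces the claim to integers. *)
Lemma ratr_integral_fermat r : ord_ge 0 (ratr r : C) -> fermat (ratr r : C).
Proof.
move=> r0; split=> //.
have co : coprime `|numq r| `|denq r| by apply: coprime_num_den.
have ordz (m : int) : coprime p `|m| -> ord (m%:~R : C) = 0%E.
  move=> /(@ord_natr_coprime _ C p_prime) <-.
  by case: m => m //; rewrite NegzE mulrNz ordN.
have den0 : ord ((denq r)%:~R : C) = 0%E.
  apply: (ordz _); rewrite prime_coprime //; apply/negP => pd.
  have num0 : ord ((numq r)%:~R : C) = 0%E.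
    by apply: ordz; rewrite coprime_sym; apply: coprime_dvdr pd co.
  have [d denE] := dvdnP pd.
  have : ord_ge 1 ((numq r)%:~R : C); last by rewrite (ord_ge_fin _ num0).
  rewrite -[(numq r)%:~R](@divfK _ (denq r)%:~R) ?intrC_eq0 ?denq_neq0 //.
  rewrite -[1]add0r; apply: ord_geM => //.
  rewrite -absz_denq denE -pmulrn natrM -[1]add0r.
  by apply: ord_geM; [exact: ord_ge_natr|rewrite (ord_ge_fin _ (ord_p C))].
set a : C := (numq r)%:~R; set b : C := (denq r)%:~R.
have [a0 a1] := fermat_int (numq r); have [b0 b1] := fermat_int (denq r).
have bn0 : b != 0 by rewrite intrC_eq0 denq_neq0.
have -> : ratr r ^+ p - ratr r =
    ((a ^+ p - a) * b - a * (b ^+ p - b)) * (b ^+ p.+1)^-1 :> C.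
  rewrite /ratr -/a -/b expr_div_n exprS invfM.
  by field; rewrite expf_neq0.
rewrite -[1]addr0; apply: ord_geM; last first.
  by rewrite (ord_ge_fin _ (ordV_fin (ordX_fin _ den0))) mul0r oppr0.
apply: ord_geB; first by rewrite -[1]addr0; apply: ord_geM.
by rewrite -[1]add0r; apply: ord_geM.
Qed.

(** Horner induction: modulo p, (P X + c)^p is P^p X^p + c^p, and c^p is c. *)
Lemma frobenius_poly (P : {poly C}) : (forall i, fermat P`_i) ->
  exists2 Q, Q \is a polyOver Oring & P ^+ p = (P \Po 'X^p) + p%:R * Q.
Proof.
have p0 := prime_gt0 p_prime.
elim/poly_ind: P => [|P c IH] ferP.
  exists 0; first exact: rpred0.
  by rewrite comp_poly0 expr0n gtn_eqF // mulr0 addr0.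
have ferP' i : fermat P`_i.
  by have := ferP i.+1; rewrite coefD coefMX coefC /= addr0.
have [c0 c1] : fermat c by have := ferP 0%N; rewrite coefD coefMX coefC /= add0r.
have [Q QO eQ] := IH ferP'.
have /p_divisibleP[d dO ed] := c1.
have PO : P * 'X \is a polyOver Oring.
  by rewrite rpredM ?polyOverX //; apply/polyOverP => i; case: (ferP' i).
have cO : c%:P \is a polyOver Oring by rewrite polyOverC.
have [Z ZO ->] := exprD_prime p_prime PO cO.
exists (Q * 'X^p + d%:P + Z).
  by rewrite !rpredD ?rpredM ?rpredX ?polyOverX ?polyOverC.
have cp : c ^+ p = c + p%:R * d by rewrite -ed addrC subrK.
rewrite exprMn eQ -rmorphXn /= cp comp_polyD comp_polyM comp_polyX comp_polyC.
by rewrite rmorphD rmorphM /= polyC_natr; ring.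
Qed.

End IntegerRing.

(** * The Artin-Hasse series *)

Section ArtinHasse.
Context {p : nat} {C : padic_complex p}.
Hypothesis p_prime : prime p.

(** As f has no constant term, f^l starts in degree at least l. Hence neither powers nor
    coefficients beyond m matter, and one truncation serves all m <= N. *)
Lemma exp_series_poly (f : nat -> C) N m : f 0%N = 0 -> (m <= N)%N ->
  exp_series f m = (exp_poly N (\poly_(i < N.+1) f i))`_m.
Proof.
move=> f0 mN; rewrite /exp_series /exp_poly !coef_sum.
have trunc : eqX m.+1 (\poly_(i < m.+1) f i) (\poly_(i < N.+1) f i).
  by move=> i im; rewrite !coef_poly im (leq_trans im).
have nth0 : (\poly_(i < N.+1) f i)`_0 = 0 by rewrite coef_poly.
rewrite (big_ord_widen N.+1 (fun l => ((l`!%:R)^-1 *: (\poly_(i < m.+1) f i) ^+ l)`_m)) //.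
rewrite big_mkcond; apply: eq_bigr => l _; rewrite !coefZ; case: ltnP => lm.
  by rewrite (eqX_exp _ trunc).
by rewrite coef_exp_small ?mulr0.
Qed.

Lemma exp_series_0 (f : nat -> C) : f 0%N = 0 -> exp_series f 0 = 1.
Proof.
move=> f0; rewrite /exp_series big_ord_recl big_ord0 addr0 expr0 coefZ coefC.
by rewrite mulr1 invr1.
Qed.

Lemma exp_series_rec (f : nat -> C) m : f 0%N = 0 ->
  m%:R * exp_series f m =
  \sum_(i < m.+1) exp_series f i * ((m - i)%:R * f (m - i)%N).
Proof.
move=> f0; set F := \poly_(i < m.+1) f i.
have F0 : F`_0 = 0 by rewrite coef_poly.
rewrite (exp_series_poly f0 (leqnn m)) -coef_theta.
rewrite (theta_exp_poly (natrC_neq0 p_prime) F0) // coefM.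
apply: eq_bigr => i _; rewrite (exp_series_poly f0 (leq_ord i)) coef_theta coef_poly.
by rewrite ltnS leq_subr.
Qed.

(** The operator x d/dx cancels the denominators p^k of the exponent, and at most one k contributes
    to each degree. *)
Lemma AH_exponentE (gamma : C) m :
  m%:R * AH_exponent gamma m = (p.-nat m)%:R * gamma ^+ m.
Proof.
rewrite /AH_exponent; case: (boolP (p.-nat m)) => [/p_natP[k mE]|np].
  have kp : (k < m.+1)%N by rewrite ltnS mE ltnW // ltn_expl // prime_gt1.
  rewrite (big_pred1 (Ordinal kp)) => [|i /=].
    rewrite /= -mE mul1r mulrC divfK // mE -[(p ^ k)%N]prednK ?natrC_neq0 //.
    by rewrite expn_gt0 prime_gt0.
  rewrite {1}mE eqn_exp2l ?prime_gt1 //; exact: eq_sym.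
rewrite big_pred0 ?mulr0 ?mul0r // => i; apply/eqP => mE.
by move: np; rewrite mE pnatX pnat_id.
Qed.

Lemma AH_exponent_0 (gamma : C) : AH_exponent gamma 0 = 0.
Proof.
by rewrite /AH_exponent big_pred0 // => i; rewrite ltn_eqF // expn_gt0 prime_gt0.
Qed.

Lemma Theta_0 (gamma : C) : Theta gamma 0 = 1.
Proof. exact/exp_series_0/AH_exponent_0. Qed.

Lemma Theta_rec (gamma : C) m :
  m%:R * Theta gamma m =
  \sum_(i < m.+1) Theta gamma i * ((p.-nat (m - i)%N)%:R * gamma ^+ (m - i)).
Proof.
rewrite exp_series_rec ?AH_exponent_0 //.
by apply: eq_bigr => i _; rewrite AH_exponentE.
Qed.

Definition artin_hasse : nat -> C := Theta 1.

Lemma artin_hasse_0 : artin_hasse 0 = 1.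
Proof. exact: Theta_0. Qed.

Lemma artin_hasse_rec m :
  m%:R * artin_hasse m = \sum_(i < m.+1) artin_hasse i * (p.-nat (m - i)%N)%:R.
Proof. by rewrite Theta_rec; apply: eq_bigr => i _; rewrite expr1n mulr1. Qed.

Lemma artin_hasse_rec_lt m :
  m%:R * artin_hasse m = \sum_(i < m) artin_hasse i * (p.-nat (m - i)%N)%:R.
Proof. by rewrite artin_hasse_rec big_ord_recr /= subnn mulr0 addr0. Qed.

(** The recurrence determines the coefficients in characteristic 0 and is homogeneous: gamma^(m-i)
    completes gamma^i to gamma^m. *)
Lemma ThetaE (gamma : C) m : Theta gamma m = gamma ^+ m * artin_hasse m.
Proof.
elim/ltn_ind: m => -[|m] IH; first by rewrite Theta_0 artin_hasse_0 mulr1.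
apply: (mulfI (natrC_neq0 (C := C) p_prime m)).
rewrite mulrCA artin_hasse_rec_lt Theta_rec big_ord_recr /= subnn mul0r mulr0 addr0.
rewrite mulr_sumr; apply: eq_bigr => i _; rewrite IH //.
have -> : gamma ^+ m.+1 = gamma ^+ (m.+1 - i) * gamma ^+ i.
  by rewrite -exprD subnK // ltnW.
by ring.
Qed.

Lemma artin_hasse_rat m : exists r, artin_hasse m = ratr r.
Proof.
elim/ltn_ind: m => -[|m] IH; first by exists 1; rewrite artin_hasse_0 ratrC_1.
suff [s es] : exists s, \sum_(i < m.+1) artin_hasse i * (p.-nat (m.+1 - i)%N)%:R = ratr s.
  exists (m.+1%:R^-1 * s); rewrite ratrC_M // ratrC_V // ratr_nat -es.
  by rewrite -artin_hasse_rec_lt mulKf ?natrC_neq0.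
apply: (big_ind (fun x : C => exists s, x = ratr s)).
- by exists 0; rewrite ratrC_0.
- by move=> _ _ [s ->] [t ->]; exists (s + t); rewrite ratrC_D.
- move=> i _; have [s ->] := IH i (ltn_ord i).
  by exists (s * (p.-nat (m.+1 - i)%N)%:R); rewrite ratrC_M // ratr_nat.
Qed.

(** This is the coefficient of x^i in exp(p x); its order i - logn p i! is a positive integer by
    [logn_fact_lt]. *)
Lemma ord_ge_expn_fact i : (2 < p)%N -> (0 < i)%N ->
  ord_ge 1 ((i`!%:R : C)^-1 * p%:R ^+ i).
Proof.
move=> p2 i0; rewrite -natrX.
have h := ordM_fin (ordV_fin (ord_natr (C := C) p_prime (fact_gt0 i)))
                   (ord_natX_p (C := C) i).
rewrite (ord_ge_fin _ h) addrC -natrB ?ler1n ?subn_gt0 ?logn_fact_lt //.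
exact/ltnW/logn_fact_lt.
Qed.

(* Comparing the coefficients of x^m in Dwork's identity
   E(x)^p = E(x^p) exp(p x): if the previous coefficients are integral, then
   E_{<m}(x)^p = E_{<m}(x^p) mod p and exp(p x) = 1 mod p leave p e_m = 0
   mod p. *)
Lemma artin_hasse_integral m : (2 < p)%N -> ord_ge 0 (artin_hasse m).
Proof.
move=> p2; have p0 := prime_gt0 p_prime.
elim/ltn_ind: m => -[|m] IH; first by rewrite artin_hasse_0 (ord_ge_fin _ ord_1).
have /(_ m.+1) := dwork_identity (natrC_neq0 p_prime) p_prime (Theta_0 1) artin_hasse_rec.
set P := \poly_(i < m.+2) artin_hasse i; set G := exp_poly _ _.
move=> /(_ m.+1 (ltnSn _)); pose P' := \poly_(i < m.+1) artin_hasse i.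
have PE : P = P' + artin_hasse m.+1 *: 'X^(m.+1).
  apply/polyP => i; rewrite coefD coefZ coefXn !coef_poly ltnS leq_eqVlt.
  by have [->|im] := eqVneq i m.+1; rewrite ?ltnn ?mulr1 ?add0r //= mulr0 addr0.
have ferP' i : fermat P'`_i.
  rewrite coef_poly; case: ltnP => im; last exact: (fermat_int p_prime 0).
  have [r er] := artin_hasse_rat i; rewrite er.
  by apply: ratr_integral_fermat => //; rewrite -er IH.
have [Q QO eQ] := frobenius_poly p_prime ferP'.
have P'0 : P'`_0 = 1 by rewrite coef_poly artin_hasse_0.
have lhs : (P ^+ p)`_m.+1 = (P' ^+ p)`_m.+1 + p%:R * artin_hasse m.+1.
  by rewrite PE coef_expD_top.
have compE i : (i <= m.+1)%N -> (P \Po 'X^p)`_i = (P' \Po 'X^p)`_i.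
  move=> im; rewrite !coef_comp_poly_Xn //; case: ifP => // pdi.
  rewrite PE coefD coefZ coefXn ltn_eqF ?mulr0 ?addr0 //.
  case: i im {pdi} => [|i] im; first by rewrite div0n.
  by apply: leq_trans im; rewrite ltn_Pdiv // prime_gt1.
have rhs : ord_ge 1 (((P \Po 'X^p) * G)`_m.+1 - (P' \Po 'X^p)`_m.+1).
  rewrite coefMr big_ord_recl subn0 compE //.
  have -> : G`_0 = 1 by rewrite coef_exp_polyZX // expr0 mulr1 invr1.
  rewrite mulr1 addrAC subrr add0r; apply: ord_ge_sum => i _.
  rewrite compE ?leq_subr // -[1]add0r; apply: ord_geM.
    rewrite coef_comp_poly_Xn //; case: ifP => _; last exact: ord_ge0.
    by case: (ferP' ((m.+1 - lift ord0 i) %/ p)%N).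
  by rewrite coef_exp_polyZX ?leq_ord //; apply: ord_ge_expn_fact.
rewrite lhs eQ coefD -polyC_natr mul_polyC coefZ => e.
have QmO : ord_ge 0 Q`_m.+1 by apply: (polyOverP QO).
have /(p_divisibleP)[z z0 ez] : ord_ge 1 (p%:R * artin_hasse m.+1).
  rewrite (_ : p%:R * artin_hasse m.+1 =
    ((P \Po 'X^p) * G)`_m.+1 - (P' \Po 'X^p)`_m.+1 - p%:R * Q`_m.+1); last first.
    by rewrite -e; ring.
  by apply: ord_geB => //; apply/p_divisibleP; exists Q`_m.+1.
by rewrite (mulfI (ord_neq0 (ord_p C)) ez).
Qed.

(** Below p the only power of p is 1, so the recurrence reduces to (m+1) e_(m+1) = e_m with m+1
    prime to p. *)
Lemma ord_artin_hasse m : (m < p)%N -> ord (artin_hasse m) = 0%E.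
Proof.
elim: m => [|m IH] mp; first by rewrite artin_hasse_0 ord_1.
have rec : m.+1%:R * artin_hasse m.+1 = artin_hasse m.
  rewrite artin_hasse_rec_lt big_ord_recr /= subSnn mulr1 big1 ?add0r // => i _.
  rewrite pnat_prime_rec // (gtn_eqF (_ : 1 < m.+1 - i)%N) ?ltn_subRL ?addn1 ?ltnS //=.
  rewrite gtnNdvd ?mulr0 //; first by rewrite subn_gt0 ltnW // ltnS.
  by apply: leq_ltn_trans mp; rewrite leq_subr.
have := congr1 (@ord p C) rec; rewrite IH ?(ltnW mp) // ordM ord_natr //.
rewrite logn_coprime; last by rewrite prime_coprime // gtnNdvd.
by rewrite add0e.
Qed.

End ArtinHasse.

(** * Limits and Q_p *)

Section Limits.
Context {p : nat} {C : padic_complex p}.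
Implicit Types (x y : C) (r s : rat) (u v : nat -> C).

Let cvg u l := converges_to (@ord p C) u l.

Lemma ord_ge_ex x : exists r, ord_ge r x.
Proof.
have [->|x0] := eqVneq x 0; first by exists 0; apply: ord_ge0.
by have [r xr] := ord_fin x0; exists r; rewrite (ord_ge_fin _ xr).
Qed.

Lemma cvg_uniq u l l' : cvg u l -> cvg u l' -> l = l'.
Proof.
move=> ul ul'; apply/eqP; rewrite -subr_eq0; apply/eqP/ord_ge_all_eq0 => M.
have [N hN] := ul M; have [N' hN'] := ul' M.
rewrite (_ : l - l' = (u (maxn N N') - l') - (u (maxn N N') - l)); last by ring.
by apply: ord_geB; [apply: hN'; rewrite leq_maxr|apply: hN; rewrite leq_maxl].
Qed.

Lemma plimE u l : cvg u l -> plim u = l.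
Proof.
move=> ul; rewrite /plim; case: xgetP => [l' _ ul'|/(_ l)//].
exact: cvg_uniq ul' ul.
Qed.

Lemma cvgD u v l l' : cvg u l -> cvg v l' -> cvg (fun i => u i + v i) (l + l').
Proof.
move=> ul vl M; have [N hN] := ul M; have [N' hN'] := vl M.
exists (maxn N N') => i; rewrite geq_max => /andP[/hN h /hN' h'].
by rewrite opprD addrACA; apply: ord_geD.
Qed.

Lemma cvg_mull u l x : cvg u l -> cvg (fun i => x * u i) (x * l).
Proof.
move=> ul M; have [r xr] := ord_ge_ex x; have [N hN] := ul (M - r).
exists N => i /hN h; rewrite -mulrBr -[M](subrKC r); exact: ord_geM.
Qed.

Lemma cvg_sum n (u : 'I_n -> nat -> C) (l : 'I_n -> C) :
  (forall k, cvg (u k) (l k)) -> cvg (fun i => \sum_(k < n) u k i) (\sum_(k < n) l k).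
Proof.
elim: n u l => [|n IH] u l ul.
  by move=> M; exists 0%N => i _; rewrite !big_ord0 subr0 ord_0 leey.
rewrite big_ord_recl.
rewrite (_ : (fun i => _) = (fun i => u ord0 i + \sum_(k < n) u (lift ord0 k) i)).
  by apply: cvgD => //; apply: IH.
by apply/funext => i; rewrite big_ord_recl.
Qed.

Lemma ord_ge_lim u l x r : cvg u l ->
  (exists N, forall i, (N <= i)%N -> ord_ge r (u i - x)) -> ord_ge r (l - x).
Proof.
move=> ul [N' hN']; have [N hN] := ul r.
rewrite (_ : l - x = (u (maxn N N') - x) - (u (maxn N N') - l)); last by ring.
by apply: ord_geB; [apply: hN'; rewrite leq_maxr|apply: hN; rewrite leq_maxl].
Qed.

Lemma Qp_lim u l : cvg u l -> (forall i, Qp (u i)) -> Qp l.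
Proof.
move=> ul uQ M; have [N hN] := ul M; have [r ur] := uQ N M; exists r.
rewrite (_ : l - ratr r = (u N - ratr r) - (u N - l)); last by ring.
by apply: ord_geB => //; apply: hN.
Qed.

Lemma Qp_ratr r : Qp (ratr r : C).
Proof. by move=> M; exists r; rewrite subrr ord_0 leey. Qed.

Section QpRing.
Hypothesis p_prime : prime p.

Lemma QpD x y : Qp x -> Qp y -> Qp (x + y).
Proof.
move=> xQ yQ M; have [r xr] := xQ M; have [s ys] := yQ M; exists (r + s).
by rewrite ratrC_D // opprD addrACA; apply: ord_geD.
Qed.

Lemma QpM x y : Qp x -> Qp y -> Qp (x * y).
Proof.
move=> xQ yQ M; have [cx xcx] := ord_ge_ex x; have [cy ycy] := ord_ge_ex y.
(* Precision [M - cx] controls x (y - s); precision [cy] makes s inherit the bound of y, which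
   controls s (x - r). *)
have [s ys] := yQ (Num.max (M - cx) cy); have [r xr] := xQ (M - cy).
exists (r * s); rewrite ratrC_M //.
have scy : ord_ge cy (ratr s : C).
  rewrite -(subKr y (ratr s)); apply: ord_geB => //.
  by apply: ord_geW ys; rewrite le_max lexx orbT.
rewrite (_ : _ - _ = x * (y - ratr s) + ratr s * (x - ratr r)); last by ring.
apply: ord_geD.
  rewrite -/(ord_ge M _) -[M](subrKC cx); apply: ord_geM => //.
  by apply: ord_geW ys; rewrite le_max lexx.
by rewrite -/(ord_ge M _) -[M](subrKC cy); apply: ord_geM.
Qed.

Lemma QpN x : Qp x -> Qp (- x).
Proof.
move=> xQ M; have [r xr] := xQ M; exists (- r).
have -> : ratr (- r) = - ratr r :> C.
  by apply/eqP; rewrite -addr_eq0 -ratrC_D // addNr ratrC_0.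
by rewrite -opprD -/(ord_ge M _) ord_geN.
Qed.

Lemma Qp_natrV n : Qp (n%:R^-1 : C).
Proof. by rewrite -ratr_nat -ratrC_V //; apply: Qp_ratr. Qed.

Lemma Qp_exp x n : Qp x -> Qp (x ^+ n).
Proof.
move=> xQ; elim: n => [|n IH]; last by rewrite exprS; apply: QpM.
by rewrite expr0 -ratrC_1; apply: Qp_ratr.
Qed.

Lemma Qp_sum n (F : 'I_n -> C) : (forall i, Qp (F i)) -> Qp (\sum_(i < n) F i).
Proof.
move=> FQ; elim/big_ind: _ => //; last exact: QpD.
by rewrite -ratrC_0; apply: Qp_ratr.
Qed.

End QpRing.

(** * Triple series: dominant terms, tails and convergence *)

Lemma ord_ge_sum_sub r (F F' : nat -> C) N N' : (N <= N')%N ->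
  (forall i, ord_ge r (F' i - F i)) ->
  (forall i, (N <= i)%N -> ord_ge r (F' i)) ->
  ord_ge r (\sum_(i < N') F' i - \sum_(i < N) F i).
Proof.
move=> NN' hFF' hF'; rewrite -(subnKC NN') big_split_ord /= addrAC -sumrB.
by apply: ord_geD; apply: ord_ge_sum => i _ //; apply: hF'; rewrite leq_addr.
Qed.

(** Subtracting an approximation x of [F k], rather than [F k] itself, lets the lemma be iterated
    through nested sums. *)
Lemma ord_ge_sum_lead r (F : nat -> C) x k N : (k < N)%N ->
  (forall i, i != k -> ord_ge r (F i)) -> ord_ge r (F k - x) ->
  ord_ge r (\sum_(i < N) F i - x).
Proof.
move=> kN hF hk; rewrite (bigD1 (Ordinal kN)) //= addrAC; apply: ord_geD => //.
apply: ord_ge_sum => i /eqP ik; apply: hF.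
by apply: contra_notN ik => /eqP ik; apply/val_inj.
Qed.

Definition tsum (W : nat -> nat -> nat -> C) N : C :=
  \sum_(l < N) \sum_(m < N) \sum_(k < N) W l m k.

Lemma tsum_lead r W l0 m0 k0 N : (l0 < N)%N -> (m0 < N)%N -> (k0 < N)%N ->
  (forall l m k, (l, m, k) != (l0, m0, k0) -> ord_ge r (W l m k)) ->
  ord_ge r (tsum W N - W l0 m0 k0).
Proof.
move=> lN mN kN hW; rewrite /tsum.
apply: (ord_ge_sum_lead (F := fun l => \sum_(m < N) \sum_(k < N) W l m k) lN).
  move=> l ll0; do 2!apply: ord_ge_sum => ? _; apply: hW.
  by apply: contraNneq ll0 => -[->].
apply: (ord_ge_sum_lead (F := fun m => \sum_(k < N) W l0 m k) mN).
  by move=> m mm0; apply: ord_ge_sum => ? _; apply: hW; apply: contraNneq mm0 => -[->].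
apply: (ord_ge_sum_lead (F := fun k => W l0 m0 k) kN); last by rewrite subrr ord_ge0.
by move=> k kk0; apply: hW; apply: contraNneq kk0 => -[->].
Qed.

Lemma tsum_tail r W N N' : (N <= N')%N ->
  (forall l m k, (N <= l + m + k)%N -> ord_ge r (W l m k)) ->
  ord_ge r (tsum W N' - tsum W N).
Proof.
move=> NN' hW; rewrite /tsum.
apply: (ord_ge_sum_sub (F' := fun l => \sum_(m < N') \sum_(k < N') W l m k)
                       (F := fun l => \sum_(m < N) \sum_(k < N) W l m k)) => // l; last first.
  move=> Nl; do 2!apply: ord_ge_sum => ? _; apply: hW.
  by rewrite -addnA (leq_trans Nl) ?leq_addr.
apply: (ord_ge_sum_sub (F' := fun m => \sum_(k < N') W l m k)
                       (F := fun m => \sum_(k < N) W l m k)) => // m; last first.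
  move=> Nm; apply: ord_ge_sum => ? _; apply: hW.
  by rewrite addnAC (leq_trans Nm) ?leq_addl.
apply: (ord_ge_sum_sub (F' := fun k => W l m k) (F := fun k => W l m k)) => // k.
  by rewrite subrr ord_ge0.
by move=> Nk; apply: hW; rewrite (leq_trans Nk) ?leq_addl.
Qed.

Lemma tsum_cvg W (c d : rat) : 0 < d ->
  (forall l m k, ord_ge ((l + m + k)%:R * d - c) (W l m k)) ->
  exists L, cvg (tsum W) L.
Proof.
move=> d0 hW; apply: Cp_complete => M.
(* An index sum of at least (M + c) / d pushes the lower bound of the terms above M. *)
pose N := Num.bound `|(M + c) / d|; exists N => i j Ni Nj.
have small l m k : (N <= l + m + k)%N -> ord_ge M (W l m k).
  move=> Nlmk; apply: ord_geW (hW l m k); rewrite lerBrDr -ler_pdivrMr //.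
  apply: le_trans (ler_norm _) _; apply: le_trans (ltW (archi_boundP (normr_ge0 _))) _.
  by rewrite ler_nat.
rewrite (_ : _ - _ = (tsum W i - tsum W N) - (tsum W j - tsum W N)); last by ring.
by apply: ord_geB; apply: tsum_tail.
Qed.

Lemma tsum_sum n (V : 'I_n -> nat -> nat -> nat -> C) N :
  tsum (fun l m k => \sum_(i < n) V i l m k) N = \sum_(i < n) tsum (V i) N.
Proof.
rewrite /tsum [RHS]exchange_big; apply: eq_bigr => l _.
rewrite [RHS]exchange_big; apply: eq_bigr => m _.
by rewrite [RHS]exchange_big.
Qed.

Lemma tsum_mull x W N : tsum (fun l m k => x * W l m k) N = x * tsum W N.
Proof.
rewrite /tsum mulr_sumr; apply: eq_bigr => l _.
by rewrite mulr_sumr; apply: eq_bigr => m _; rewrite mulr_sumr.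
Qed.

End Limits.

(** * Rationality of gamma^(p-1) over Q_p *)

Section Gamma.
Context {p : nat} {C : padic_complex p}.
Hypothesis p_prime : prime p.
Variable gamma : C.
Hypothesis gammaP : is_gamma gamma.

(* y = gamma^(p-1) is the fixed point of
   y |-> - p - sum_(k >= 2) p^(1-k) y^((p^k-1)/(p-1)),
   which contracts the elements of order >= 1. *)
Lemma gamma_exp_Qp : Qp (gamma ^+ p.-1).
Proof.
have [root_gamma ord_gamma] := gammaP; set y := gamma ^+ p.-1.
have p1 : (1 < p)%N := prime_gt1 p_prime.
have p1n0 : p.-1%:R != 0 :> rat by rewrite pnatr_eq0 -lt0n -subn1 subn_gt0.
have ord_y : ord y = 1%:E by rewrite (ordX_fin _ ord_gamma) mulVf.
have pn0 : p%:R != 0 :> C := ord_neq0 (ord_p C).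
have gamma0 := ord_neq0 ord_gamma.
(* Here [e k] is (p^(k+2) - 1)/(p - 1), so that gamma^(p^(k+2)) = gamma y^(e k); the terms of index
   0 and 1 are treated apart. *)
pose e k : nat := (\sum_(i < k.+2) p ^ i)%N.
have e_gt k : (k.+3 <= e k)%N.
  elim: k => [|k IH]; first by rewrite /e big_ord_recr big_ord1 /= expn0 expn1.
  by rewrite /e big_ord_recr -addn1 leq_add // expn_gt0 ltnW.
have gammaX k : gamma ^+ (p ^ k.+2) = gamma * y ^+ e k.
  by rewrite -exprM -exprS -predn_exp prednK // expn_gt0 ltnW.
pose T N (x : C) := \sum_(k < N) x ^+ e k / (p ^ k.+1)%:R.
have approx j : exists2 z, Qp z & ord_ge j.+1%:R (y - z).
  elim: j => [|j [z zQ yz]].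
    exists 0; last by rewrite subr0 (ord_ge_fin _ ord_y).
    by rewrite -ratrC_0; apply: Qp_ratr.
  (* Multiplying the partial sum by p / gamma, of order 1 - 1/(p-1), turns this precision into j +
     2. *)
  have [N0 /(_ N0.+2)] := root_gamma (p.-1%:R^-1 + j.+1%:R).
  move=> /(_ (leq_trans (leqnSn _) (leqnSn _))); rewrite subr0 => hN.
  have small : ord_ge j.+2%:R (p%:R + y + T N0 y).
    have -> : p%:R + y + T N0 y =
        p%:R * gamma^-1 * \sum_(k < N0.+2) gamma ^+ (p ^ k) / (p ^ k)%:R.
      rewrite big_ord_recl big_ord_recl /= expn0 expn1 expr1 divr1.
      have -> : gamma ^+ p = gamma * y by rewrite -exprS prednK // ltnW.
      rewrite addrA [RHS]mulrDr; congr (_ + _); first by field; rewrite pn0.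
      rewrite mulr_sumr; apply: eq_bigr => k _; rewrite /bump !leq0n !add1n gammaX.
      rewrite [(p ^ k.+2)%N]expnS natrM natrX.
      by field; rewrite pn0 gamma0 expf_neq0.
    rewrite (_ : j.+2%:R = (1 - p.-1%:R^-1) + (p.-1%:R^-1 + j.+1%:R)); last first.
      by rewrite -natr1; ring.
    apply: ord_geM hN.
    by rewrite (ord_ge_fin _ (ordM_fin (ord_p C) (ordV_fin ord_gamma))).
  have z1 : ord_ge 1 z.
    rewrite -(subKr y z); apply: ord_geB; first by rewrite (ord_ge_fin _ ord_y).
    by apply: ord_geW yz; rewrite ler1n.
  have y1 : ord_ge 1 y by rewrite (ord_ge_fin _ ord_y).
  exists (- (p%:R + T N0 z)).
    apply: QpN => //; apply: QpD => //.
      by rewrite -ratr_nat; apply: Qp_ratr.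
    apply: Qp_sum => // k; apply: QpM => //; first exact: Qp_exp.
    exact: Qp_natrV.
  rewrite (_ : y - _ = (p%:R + y + T N0 y) - (T N0 y - T N0 z)); last by ring.
  apply: ord_geB => //; rewrite /T -sumrB; apply: ord_ge_sum => k _.
  (* Contraction: y^e - z^e is (y - z) times terms of order at least e - 1, and e >= k + 3 outweighs
     the denominator p^(k+1) with one unit to spare. *)
  have ek := e_gt k; rewrite -mulrBl subrXX.
  apply: (@ord_geW _ _ (j.+1%:R + (e k).-1%:R - k.+1%:R)).
    by rewrite lerBrDr -!natrD ler_nat; lia.
  apply: ord_geM; last by rewrite (ord_ge_fin _ (ordV_fin (ord_natX_p _))).
  apply: ord_geM => //; apply: ord_ge_sum => i _.
  apply: (@ord_geW _ _ (1 * ((e k).-1 - i)%:R + 1 * i%:R)).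
    by rewrite !mul1r -natrD ler_nat; have := ltn_ord i; lia.
  by apply: ord_geM; apply: ord_ge_exp.
move=> M; have [z zQ yz] := approx (Num.bound `|M|).
have [r zr] := zQ M; exists r.
rewrite (_ : y - _ = (y - z) + (z - ratr r)); last by ring.
apply: ord_geD => //; apply: ord_geW yz.
apply: le_trans (ler_norm _) _; apply: le_trans (ltW (archi_boundP (normr_ge0 _))) _.
by rewrite ler_nat.
Qed.

End Gamma.

(** * The coefficients B(a,b) *)

Section CoefficientsOfF.
Context {p : nat} {C : padic_complex p}.
Hypotheses (p_prime : prime p) (p_gt2 : (2 < p)%N).
Variables (n : nat) (gamma : C).
Hypotheses (n_gt0 : (0 < n)%N) (gammaP : is_gamma gamma).

Definition on_line (a b : int) (l m k : nat) : bool :=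
  (n%:Z * l%:Z - k%:Z == a) && (m%:Z - k%:Z == b).

(** Extending by 0 off the line turns the constrained sum into a sum over full cubes. *)
Definition Bterm (t : C) (a b : int) (l m k : nat) : C :=
  if on_line a b l m k
  then Theta gamma l * Theta gamma m * (Theta gamma k * t ^+ k) else 0.

Lemma B_tsum t a b : B n gamma t a b = plim (tsum (Bterm t a b)).
Proof.
rewrite /B /tsum; congr plim; apply/funext => N.
apply: eq_bigr => l _; apply: eq_bigr => m _.
by rewrite big_mkcond.
Qed.

Lemma ord_ge_Theta m : ord_ge (m%:R / p.-1%:R) (Theta gamma m).
Proof.
rewrite ThetaE // -[X in ord_ge X]addr0; apply: ord_geM.
  by rewrite (ord_ge_fin _ (ordX_fin m gammaP.2)) mulrC.
exact: artin_hasse_integral.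
Qed.

Lemma ord_Theta m : (m < p)%N -> ord (Theta gamma m) = (m%:R / p.-1%:R)%:E.
Proof.
move=> mp; rewrite ThetaE //.
by rewrite (ordM_fin (ordX_fin m gammaP.2) (ord_artin_hasse p_prime mp)) addr0 mulrC.
Qed.

Lemma ord_ge_Bterm t a b l m k : ord_ge 0 t ->
  ord_ge ((l + m + k)%:R / p.-1%:R) (Bterm t a b l m k).
Proof.
move=> t0; rewrite /Bterm; case: ifP => _; last exact: ord_ge0.
rewrite !natrD !mulrDl; apply: ord_geM; first by apply: ord_geM; apply: ord_ge_Theta.
rewrite -[X in ord_ge X]addr0; apply: ord_geM; first exact: ord_ge_Theta.
by have := ord_ge_exp k t0; rewrite mul0r.
Qed.

Lemma B_cvg t a b : ord_ge 0 t ->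
  converges_to (@ord p C) (tsum (Bterm t a b)) (B n gamma t a b).
Proof.
move=> t0; have [|l m k|L cvL] := @tsum_cvg p C (Bterm t a b) 0 p.-1%:R^-1.
- by rewrite invr_gt0 ltr0n -subn1 subn_gt0 prime_gt1.
- by rewrite subr0; apply: ord_ge_Bterm.
by rewrite B_tsum (plimE cvL).
Qed.

(* The solutions of n l - k = a, m - k = b form a half-line of direction
   (1, n, n), so the one with the least k dominates the sum. *)
Lemma ord_B t a b l0 m0 k0 : ord t = 0%E -> on_line a b l0 m0 k0 ->
  (l0 < p)%N -> (m0 < p)%N -> (k0 < p)%N ->
  (forall l m k, on_line a b l m k -> (k0 <= k)%N) ->
  ord (B n gamma t a b) = ((l0 + m0 + k0)%:R / p.-1%:R)%:E.
Proof.
move=> t0 on0 l0p m0p k0p k0_min.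
have t_ge0 : ord_ge 0 t by rewrite (ord_ge_fin _ t0).
have d_gt0 : 0 < p.-1%:R^-1 :> rat by rewrite invr_gt0 ltr0n -subn1 subn_gt0 prime_gt1.
have ord_lead : ord (Bterm t a b l0 m0 k0) = ((l0 + m0 + k0)%:R / p.-1%:R)%:E.
  rewrite /Bterm on0.
  rewrite (ordM_fin (ordM_fin (ord_Theta l0p) (ord_Theta m0p))
                    (ordM_fin (ord_Theta k0p) (ordX_fin k0 t0))).
  by rewrite mul0r addr0 !natrD !mulrDl.
(* Every other point of the line has an index sum larger by at least one, so the remaining terms
   have strictly larger order. *)
apply: (@ord_perturb _ _ _ ((l0 + m0 + k0).+1%:R / p.-1%:R) _ _ ord_lead); last first.
  by rewrite ltr_pM2r // ltr_nat.
apply: (ord_ge_lim (B_cvg a b t_ge0)); exists p => N pN.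
apply: tsum_lead; rewrite ?(leq_trans _ pN) // => l m k neq.
case: (boolP (on_line a b l m k)) => [on|]; last first.
  by rewrite /Bterm => /negPf ->; apply: ord_ge0.
apply: ord_geW (ord_ge_Bterm a b l m k t_ge0); rewrite ler_pM2r // ler_nat.
have k0k := k0_min _ _ _ on.
have /andP[/eqP e1 /eqP e2] := on; have /andP[/eqP e3 /eqP e4] := on0.
have m0m : (m0 <= m)%N by lia.
have l0l : (l0 <= l)%N.
  rewrite -(@leq_pmul2l n) //; have : (n * l0)%:Z <= (n * l)%:Z by rewrite !PoszM; lia.
  by [].
have : (k0 < k)%N; last by lia.
rewrite ltn_neqAle k0k andbT; apply: contraNneq neq => k0E.
have -> : m = m0 by lia.
have -> : l = l0; last by rewrite k0E.
apply/eqP; rewrite -(@eqn_pmul2l n) //; apply/eqP.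
by have : (n * l)%:Z = (n * l0)%:Z by [rewrite !PoszM; lia|]; case.
Qed.

(* Since gamma^(p-1) lies in Q_p and t^Q = 1, the dependency of B on t and on
   gamma is polynomial over Q_p. *)
Lemma B_decomp (Q : nat) a b : (0 < Q)%N ->
  exists2 c : 'I_p.-1 -> 'I_Q -> C, (forall i j, Qp (c i j)) &
  forall t, t ^+ Q = 1 ->
    B n gamma t a b = \sum_(i < p.-1) \sum_(j < Q) gamma ^+ i * t ^+ j * c i j.
Proof.
move=> Q0; set y := gamma ^+ p.-1; set e := @artin_hasse p C.
have pm1 : (0 < p.-1)%N by rewrite -subn1 subn_gt0 prime_gt1.
have yQ : Qp y := gamma_exp_Qp p_prime gammaP.
have ord_y : ord y = 1%:E.
  by rewrite (ordX_fin _ gammaP.2) mulVf // pnatr_eq0 -lt0n.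
(* The terms are sorted by l + m + k modulo p - 1 and k modulo Q, with gamma^i t^j taken out. What
   remains lies in Q_p and does not involve t, so the same c serves every t. *)
pose W (i : 'I_p.-1) (j : 'I_Q) l m k :=
  if on_line a b l m k && (((l + m + k) %% p.-1)%N == i) && ((k %% Q)%N == j)
  then y ^+ ((l + m + k) %/ p.-1) * (e l * e m * e k) else 0.
(* The loss of 1 pays for the rounding in the exponent of y. *)
have ord_W i j l m k : ord_ge ((l + m + k)%:R / p.-1%:R - 1) (W i j l m k).
  rewrite /W; case: ifP => _; last exact: ord_ge0.
  apply: (@ord_geW _ _ (1 * ((l + m + k) %/ p.-1)%:R + 0)).
    rewrite mul1r addr0 lerBlDr ler_pdivrMr ?ltr0n // natr1 -natrM ler_nat.
    by rewrite ltnW // ltn_ceil.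
  apply: ord_geM; first by apply: ord_ge_exp; rewrite (ord_ge_fin _ ord_y).
  rewrite -[0]addr0; apply: ord_geM; last exact: artin_hasse_integral.
  by rewrite -[0]addr0; apply: ord_geM; apply: artin_hasse_integral.
have W_cvg i j : exists L, converges_to (@ord p C) (tsum (W i j)) L.
  by apply: tsum_cvg (ord_W i j); rewrite invr_gt0 ltr0n.
pose c i j := projT1 (cid (W_cvg i j)).
have cP i j : converges_to (@ord p C) (tsum (W i j)) (c i j) := projT2 (cid (W_cvg i j)).
have eQ m : Qp (e m).
  by have [r er] := artin_hasse_rat (C := C) p_prime m; rewrite /e er; apply: Qp_ratr.
exists c => [i j|t tQ].
  apply: Qp_lim (cP i j) _ => N.
  do 3!(apply: (Qp_sum p_prime) => ?); rewrite /W; case: ifP => _.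
    by do !apply: (QpM p_prime) => //; apply: Qp_exp.
  by rewrite -ratrC_0; apply: Qp_ratr.
have t_ge0 : ord_ge 0 t.
  have h : ord (t ^+ Q) = 0%:E by rewrite tQ ord_1.
  by rewrite (ord_ge_fin _ (ord_of_exp Q0 h)) mul0r.
apply: cvg_uniq (B_cvg a b t_ge0) _.
rewrite (_ : tsum (Bterm t a b) = fun N =>
    \sum_(i < p.-1) \sum_(j < Q) gamma ^+ i * t ^+ j * tsum (W i j) N).
  by apply: cvg_sum => i; apply: cvg_sum => j; apply: cvg_mull.
apply/funext => N; rewrite (_ : Bterm t a b = fun l m k =>
    \sum_(i < p.-1) \sum_(j < Q) gamma ^+ i * t ^+ j * W i j l m k).
  rewrite tsum_sum; apply: eq_bigr => i _; rewrite tsum_sum; apply: eq_bigr => j _.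
  exact: tsum_mull.
apply/funext => l; apply/funext => m; apply/funext => k.
pose i0 : 'I_p.-1 := Ordinal (ltn_pmod (l + m + k) pm1).
pose j0 : 'I_Q := Ordinal (ltn_pmod k Q0).
rewrite (bigD1 i0) //= (bigD1 j0) //= big1 => [|j jj0]; last first.
  rewrite /W [_ == nat_of_ord j](_ : _ = false) ?andbF ?mulr0 //.
  by apply: contraNF jj0 => /eqP h; apply/eqP/val_inj.
rewrite big1 => [|i ii0]; last first.
  apply: big1 => j _; rewrite /W [_ == nat_of_ord i](_ : _ = false) ?andbF ?mulr0 //.
  by apply: contraNF ii0 => /eqP h; apply/eqP/val_inj.
rewrite !addr0 /Bterm /W !eqxx !andbT; case: ifP => _; last by rewrite mulr0.
have -> : t ^+ k = t ^+ (k %% Q).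
  by rewrite {1}(divn_eq k Q) exprD mulnC exprM tQ expr1n mul1r.
rewrite !ThetaE // -/e.
have : gamma ^+ (l + m + k) = gamma ^+ ((l + m + k) %% p.-1) * y ^+ ((l + m + k) %/ p.-1).
  by rewrite {1}(divn_eq (l + m + k) p.-1) addnC exprD mulnC exprM.
rewrite !exprD => h.
transitivity ((gamma ^+ l * gamma ^+ m * gamma ^+ k) * t ^+ (k %% Q) * (e l * e m * e k)).
  by ring.
by rewrite h; ring.
Qed.

End CoefficientsOfF.

(** * The inverse Frobenius *)

Section GeneratedFields.
Context {p : nat} {C : padic_complex p}.
Variable S : set C.
Implicit Types (x y : C).

Lemma field_gen_sub x : S x -> field_gen S x.
Proof. by move=> Sx K [_]; apply. Qed.

Lemma field_gen_divring : GRing.divring_closed (mem (field_gen S)).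
Proof.
split=> [|x y|x y]; rewrite !inE.
- by move=> K [[]]; rewrite inE.
- move=> xK yK K SK; have [[_ KB _] _] := SK.
  by have := KB x y; rewrite !inE; apply; [apply: xK|apply: yK].
- move=> xK yK K SK; have [[_ _ KV] _] := SK.
  by have := KV x y; rewrite !inE; apply; [apply: xK|apply: yK].
Qed.

Lemma field_gen1 : field_gen S 1.
Proof. by have [] := field_gen_divring; rewrite inE. Qed.

Lemma field_genB x y : field_gen S x -> field_gen S y -> field_gen S (x - y).
Proof. by have [_ h _] := field_gen_divring; have := h x y; rewrite !inE. Qed.

Lemma field_gen0 : field_gen S 0.
Proof. by rewrite -(subrr 1); apply: field_genB; apply: field_gen1. Qed.

Lemma field_genD x y : field_gen S x -> field_gen S y -> field_gen S (x + y).
Proof.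
move=> xK yK; rewrite -[y]opprK; apply: field_genB => //.
by rewrite -sub0r; apply: field_genB => //; apply: field_gen0.
Qed.

Lemma field_gen_div x y : field_gen S x -> field_gen S y -> field_gen S (x / y).
Proof. by have [_ _ h] := field_gen_divring; have := h x y; rewrite !inE. Qed.

Lemma field_genM x y : field_gen S x -> field_gen S y -> field_gen S (x * y).
Proof.
move=> xK yK; rewrite -[y]invrK; apply: field_gen_div => //.
by rewrite -div1r; apply: field_gen_div => //; apply: field_gen1.
Qed.

Lemma field_genX x n : field_gen S x -> field_gen S (x ^+ n).
Proof.
move=> xK; elim: n => [|n IH]; first exact: field_gen1.
by rewrite exprS; apply: field_genM.
Qed.

Lemma field_gen_sum n (F : 'I_n -> C) :
  (forall i, field_gen S (F i)) -> field_gen S (\sum_(i < n) F i).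
Proof.
move=> FK; apply: big_ind => //; [exact: field_gen0|exact: field_genD].
Qed.

End GeneratedFields.

Section Frobenius.
Context {p : nat} {C : padic_complex p}.
Hypotheses (p_prime : prime p) (p_gt2 : (2 < p)%N).
Variables (n q : nat) (gamma zeta gammat tbar : C) (sigma : C -> C).
Hypotheses (n_gt0 : (0 < n)%N) (gammaP : is_gamma gamma).
Hypotheses (gammatP : gammat ^+ n = gamma) (q_gt1 : (1 < q)%N).
Hypothesis sigmaP : is_frobenius q zeta gammat sigma.
Hypotheses (tbar_Qq : Qq q tbar) (tbarX : tbar ^+ q = tbar) (tbar_neq0 : tbar != 0).

Let K := Kfield q zeta gammat.

Let frobeniusP :
  [/\ [/\ set_bij K K sigma,
      forall x y, K x -> K y -> sigma (x + y) = sigma x + sigma y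
    & forall x y, K x -> K y -> sigma (x * y) = sigma x * sigma y],
      [/\ forall x, Qp x -> sigma x = x,
      set_bij (Qq q) (Qq q) sigma
    & forall x, Zq q x -> (0 < ord (sigma x - x ^+ p))%E],
      sigma zeta = zeta
    & sigma gammat = gammat] := sigmaP.

Lemma Qq_Kfield x : Qq q x -> K x.
Proof. by move=> xQ; apply: field_gen_sub; left. Qed.

Lemma Qp_Qq (x : C) : Qp x -> Qq q x.
Proof. by move=> xQ; apply: field_gen_sub; left. Qed.

Lemma gammat_K : K gammat.
Proof. by apply: field_gen_sub; right; right. Qed.

Lemma gamma_K : K gamma.
Proof. by rewrite -gammatP; apply: field_genX; apply: gammat_K. Qed.

Lemma sigma0 : sigma 0 = 0.
Proof.
have [[_ sD _] _ _ _] := frobeniusP.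
by apply: (addrI (sigma 0)); rewrite addr0 -sD ?addr0 //; apply: field_gen0.
Qed.

Lemma sigma_sum m (F : 'I_m -> C) :
  (forall i, K (F i)) -> sigma (\sum_(i < m) F i) = \sum_(i < m) sigma (F i).
Proof.
have [[_ sD _] _ _ _] := frobeniusP.
elim: m F => [|m IH] F FK; first by rewrite !big_ord0 sigma0.
by rewrite !big_ord_recl sD ?IH //; apply: field_gen_sum => i; apply: FK.
Qed.

Lemma sigmaX x m : K x -> sigma (x ^+ m) = sigma x ^+ m.
Proof.
have [[_ _ sM] [sQp _ _] _ _] := frobeniusP; move=> xK.
elim: m => [|m IH]; last by rewrite !exprS sM ?IH //; apply: field_genX.
by rewrite !expr0 sQp // -(ratrC_1 (C := C)); apply: Qp_ratr.
Qed.

(* By [B_decomp], sigma acts on B through the Teichmueller parameter only, so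
   that no isometry property of sigma is needed. *)
Lemma sigma_inv_B : exists2 tau, ord tau = 0%E &
  forall a b, 'pinv_id K sigma (B n gamma tbar a b) = B n gamma tau a b.
Proof.
have [[Kbij sD sM] [sQp [_ _ Qsurj] _] _ sgt] := frobeniusP.
have [_ Kinj _] := Kbij.
(* The preimage of tbar is again a (q-1)-th root of unity, by injectivity of sigma, hence has order
   0. *)
have [tau tauQ tauE] := Qsurj _ tbar_Qq.
have tauK := Qq_Kfield tauQ.
have tau0 : tau != 0.
  by apply: contra tbar_neq0 => /eqP tau0; rewrite -tauE tau0 sigma0.
have tauX : tau ^+ q = tau.
  apply: Kinj; rewrite ?inE //; first exact: field_genX.
  by rewrite sigmaX // tauE.
have q1 : (0 < q.-1)%N by rewrite -subn1 subn_gt0.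
have unity (x : C) : x != 0 -> x ^+ q = x -> x ^+ q.-1 = 1.
  move=> x0 xq; apply: (mulfI x0).
  by rewrite -exprS prednK ?xq ?mulr1 // ltnW.
exists tau => [|a b].
  have h : ord (tau ^+ q.-1) = 0%:E by rewrite unity // ord_1.
  by rewrite (ord_of_exp q1 h) mul0r.
have [c cQ cE] := B_decomp p_prime p_gt2 n gammaP a b q1.
have termK (i : 'I_p.-1) (j : 'I_q.-1) : K (gamma ^+ i * tau ^+ j * c i j).
  apply: field_genM; last by apply: Qq_Kfield; apply: Qp_Qq; apply: cQ.
  by apply: field_genM; apply: field_genX => //; apply: gamma_K.
have sgamma : sigma gamma = gamma.
  by rewrite -gammatP sigmaX ?sgt //; apply: gammat_K.
(* On the common decomposition, sigma fixes gamma and the coefficients c and sends tau to tbar. *)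
have -> : B n gamma tbar a b = sigma (B n gamma tau a b).
  rewrite !cE ?unity // sigma_sum => [|i]; last by apply: field_gen_sum => j; apply: termK.
  apply: eq_bigr => i _; rewrite sigma_sum //; apply: eq_bigr => j _.
  have gK : K (gamma ^+ i) by apply: field_genX; apply: gamma_K.
  have tK : K (tau ^+ j) by apply: field_genX.
  have cK : K (c i j) by apply: Qq_Kfield; apply: Qp_Qq; apply: cQ.
  have gtK : K (gamma ^+ i * tau ^+ j) by apply: field_genM.
  by rewrite !sM ?sigmaX ?sgamma ?tauE ?(sQp _ (cQ i j)) //; apply: gamma_K.
apply: (pinvKV (fun x => x) Kinj); rewrite inE cE ?unity //.
by apply: field_gen_sum => i; apply: field_gen_sum => j; apply: termK.
Qed.

(** A point with smaller k has l < l0, hence k <= k0 - n; this is impossible if k0 < n or l0 = 0, so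
    the given point is the first of its half-line. The second summand comes from ord gammat =
    1/(n(p-1)). *)
Lemma ord_A (u v : int * int) l0 m0 k0 :
  on_line n (p%:Z * v.1 - u.1) (p%:Z * v.2 - u.2) l0 m0 k0 ->
  (l0 < p)%N -> (m0 < p)%N -> (k0 < p)%N ->
  [|| (k0 < n)%N | l0 == 0%N] ->
  ord (A n q gamma zeta gammat tbar sigma v u) =
    ((l0 + m0 + k0)%:R / p.-1%:R
     + (nomega n u - nomega n v)%:Q / (n * p.-1)%:R)%:E.
Proof.
move=> on0 l0p m0p k0p least; rewrite /A.
have [tau tau0 ->] := sigma_inv_B.
have ord_gammat : ord gammat = ((n * p.-1)%:R^-1)%:E.
  have := gammaP.2; rewrite -gammatP => /(ord_of_exp n_gt0) ->.
  by rewrite natrM invfM mulrC.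
rewrite (ordM_fin (ord_B p_prime p_gt2 n_gt0 gammaP tau0 on0 l0p m0p k0p _)
                  (ordXz_fin _ ord_gammat)) => [|l m k on].
  by rewrite [_^-1 * _]mulrC.
have /andP[/eqP e1 /eqP e2] := on; have /andP[/eqP e3 /eqP e4] := on0.
rewrite leqNgt; apply/negP => kk0.
have : (n * l < n * l0)%N by have : (n * l)%:Z < (n * l0)%:Z by [rewrite !PoszM; lia|].
rewrite ltn_pmul2l // => ll0.
case/orP: least => [k0n|/eqP l00]; last by rewrite l00 in ll0.
have : (n * l + n <= n * l0)%N by rewrite -mulnSr leq_pmul2l.
have : (n * l0)%:Z - (n * l)%:Z = k0%:Z - k%:Z by rewrite !PoszM; lia.
lia.
Qed.

End Frobenius.

(** * Weights of the basis points, and first points of their lines *)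

Lemma nomega_eps n i : (0 < n)%N -> (i <= 2 * n)%N -> nomega n (eps n i%:Z) = i%:Z.
Proof.
move=> n0 i2n; apply: (@intr_inj rat); rewrite nomegaE //.
have nn0 : n%:R != 0 :> rat by rewrite pnatr_eq0 -lt0n.
have max0 (x y : rat) : x <= 0 -> y <= 0 -> Num.max 0 (Num.max x y) = 0.
  by move=> x0 y0; apply/max_idPl; rewrite ge_max x0 y0.
rewrite /eps /omega; rewrite lez_nat; case: leqP => ni.
  by rewrite max0 ?oppr_le0 ?ler0z // mulr0 !addr0 mulrC divfK.
rewrite max0 ?oppr_le0 ?ler0z ?subr_ge0 ?lez_nat ?(ltnW ni) //.
by rewrite mulr0 addr0 rmorphB /=; field.
Qed.

(** The bounded quantity is the residue of -x modulo n; the ceilings in [alpha] and [g] are read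
    this way. *)
Lemma ceil_div_bounds (n : nat) (x : int) : (0 < n)%N ->
  0 <= n%:Z * Num.ceil (x%:Q / n%:R) - x < n%:Z.
Proof.
move=> n0; have n0Q : 0 < n%:R :> rat by rewrite ltr0n.
have /andP[] := ceil_itv (x%:Q / n%:R); set c := Num.ceil _.
rewrite ltr_pdivlMr // ler_pdivrMr // -[n%:R]/(n%:Z%:Q) -!rmorphM ltr_int ler_int /=.
by lia.
Qed.

(** The witnesses are l0 = ceil((p j - i)/n) and the residue k0 of i - p j modulo n, which is alpha.
    The excluded pair is the one where this ceiling is -1 instead of a natural number. *)
Lemma alpha_coords (p n i j : nat) :
  (0 < n)%N -> (n < p)%N -> (i <= n)%N -> (j <= n.-1)%N -> (i, j) <> (n, 0%N) ->
  exists l0 k0 : nat, [/\ (l0 < p)%N, (k0 < n)%N,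
    n%:Z * l0%:Z - k0%:Z = p%:Z * j%:Z - i%:Z & alpha p n i j = k0%:Z].
Proof.
move=> n0 np i_n j_n ij.
have := ceil_div_bounds (p%:Z * j%:Z - i%:Z) n0.
rewrite /alpha; set c := Num.ceil _ => /andP[c_ge c_lt].
have n0Z : 0 < n%:Z by [].
have pj_le : p%:Z * j%:Z <= p%:Z * (n%:Z - 1) by rewrite ler_wpM2l //; lia.
have c_ge0 : 0 <= c.
  suff : -1 < c by lia.
  rewrite -(ltr_pM2l n0Z) mulrN1.
  have [j0|j_gt0] := posnP j.
    have i_neq_n : i != n by apply/eqP => i_eq; apply: ij; rewrite i_eq j0.
    by rewrite j0 mulr0 in c_ge; clear -c_ge i_neq_n i_n; lia.
  have : p%:Z * 1 <= p%:Z * j%:Z by rewrite ler_wpM2l //; lia.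
  by clear -c_ge i_n np; lia.
have c_lt_p : c < p%:Z.
  rewrite -(ltr_pM2l n0Z) [n%:Z * p%:Z]mulrC.
  by move: pj_le; rewrite mulrBr mulr1; clear -c_lt i_n np; lia.
case: c c_ge0 c_lt_p c_ge c_lt => // l0 _ l0p c_ge c_lt.
exists l0, `|(i%:Z - p%:Z * j%:Z + n%:Z * l0%:Z)%R|%N.
have h : 0 <= i%:Z - p%:Z * j%:Z + n%:Z * l0%:Z by clear -c_ge; lia.
rewrite gez0_abs //; split=> //; last by ring.
by rewrite -ltz_nat gez0_abs //; clear -c_lt; lia.
Qed.

(* The residue r = varpi i mod n satisfies p r = i mod n, so that alpha
   vanishes along i |-> g(i). *)
Lemma g_coords (p n w i : nat) :
  (1 < n)%N -> (n < p)%N -> p * w = 1 %[mod n] -> (0 < i < 2 * n)%N -> i != n ->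
  exists r l0 : nat, [/\ (0 < r < n)%N, (l0 < p)%N,
    w%:Z * i%:Z + n%:Z * Num.ceil ((- (w%:Z * i%:Z))%:Q / n%:R) = r%:Z
    & n%:Z * l0%:Z = p%:Z * r%:Z - i%:Z + (if (i < n)%N then 0 else n%:Z)].
Proof.
move=> n1 np pw /andP[i_gt0 i_lt] i_neq_n.
have n0 : (0 < n)%N by apply: ltnW.
have n0Z : 0 < n%:Z by [].
have := ceil_div_bounds (- (w%:Z * i%:Z)) n0.
set c := Num.ceil _; rewrite opprK addrC => /andP[r_ge0 r_lt].
set x := w%:Z * i%:Z + n%:Z * c in r_ge0 r_lt *.
have [r rE] : exists r : nat, x = r%:Z by exists `|x|%N; rewrite gez0_abs.
have [z zE] : exists z : int, p%:Z * r%:Z - i%:Z = n%:Z * z.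
  exists ((p * w %/ n)%N%:Z * i%:Z + p%:Z * c).
  have pv : p%:Z * w%:Z = (p * w %/ n)%N%:Z * n%:Z + 1.
    by rewrite -!PoszM {1}(divn_eq (p * w) n) pw modn_small.
  by rewrite -rE /x mulrDr mulrA pv; ring.
rewrite rE in r_lt *; clear pw x rE r_ge0 c.
(* If r were 0, then n would divide i, which is impossible for 0 < i < 2n with i different from
   n. *)
have r_gt0 : (0 < r)%N.
  rewrite lt0n; apply/negP => /eqP r0; rewrite r0 mulr0 sub0r in zE.
  have z_lt0 : z < 0 by rewrite -(pmulr_rlt0 z n0Z) -zE; clear -i_gt0; lia.
  have z_gt : - 2 < z by rewrite -(ltr_pM2l n0Z) -zE; clear -i_lt; lia.
  have z1 : z = - 1 by clear -z_lt0 z_gt; lia.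
  by rewrite z1 in zE; clear -zE i_neq_n; lia.
have pr_ge : p%:Z * 1 <= p%:Z * r%:Z by rewrite ler_wpM2l.
have pr_le : p%:Z * r%:Z <= p%:Z * (n%:Z - 1).
  by rewrite ler_wpM2l //; clear -r_lt; lia.
(* For i > n the points [eps] of n + r and i are (r, 1) and (i - n, 1), so the number to divide by n
   becomes p r - i + n. *)
pose z' := z + (if (i < n)%N then 0 else 1).
have z'E : n%:Z * z' = p%:Z * r%:Z - i%:Z + (if (i < n)%N then 0 else n%:Z).
  by rewrite /z' mulrDr -zE; case: ifP => _; rewrite ?mulr0 ?mulr1.
have z'_ge0 : 0 <= z'.
  rewrite -(pmulr_rge0 _ n0Z) z'E.
  by case: ltnP => in_; clear -pr_ge np in_ i_lt; lia.
have z'_lt : z' < p%:Z.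
  rewrite -(ltr_pM2l n0Z) z'E [n%:Z * p%:Z]mulrC.
  by move: pr_le; rewrite mulrBr mulr1; case: ltnP => in_; clear -in_ i_gt0 np; lia.
case: z' z'_ge0 z'_lt z'E => // l0 _ l0p l0E.
by exists r, l0; split=> //; rewrite r_gt0.
Qed.

(* The pair (i, j) = (n, 0) is excluded from the second formula: there
   alpha_{n,0} = 0, whereas A(eps_0, eps_n) = sigma^-1(B(-n, 0)) gammat^n has
   order (2n+1)/(p-1) > 0. *)
Theorem theorem2p10 (p n f : nat) (C : padic_complex p)
    (F : finFieldType) (red : C -> F) (t : F)
    (tbar zeta gamma gammat : C) (sigma : C -> C) (varpi : nat)
    (n_gt1 : (1 < n)%N) (p_prime : prime p) (p_odd : odd p)
    (n_lt_p : (n < p)%N) (f_gt0 : (0 < f)%N)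
    (cardF : #|F| = (p ^ f)%N)
    (redP : is_reduction (p ^ f) red)
    (t_neq0 : t != 0)
    (tbarP : is_teichmuller (p ^ f) red t tbar)
    (zetaP : p.-primitive_root zeta)
    (gammaP : is_gamma gamma)
    (gammatP : gammat ^+ n = gamma)
    (sigmaP : is_frobenius (p ^ f) zeta gammat sigma)
    (varpi_bounds : (0 < varpi < n)%N)
    (varpiP : p * varpi = 1 %[mod n]) :
  let A' := A n (p ^ f) gamma zeta gammat tbar sigma in
  (forall i : nat, (i <= 2 * n)%N ->
     ord (A' (eps n (g n varpi i)) (eps n i%:Z))
     = ((g n varpi i)%:Q / n%:R)%:E)
  /\
  (forall i j : nat, (i <= n)%N -> (j <= n.-1)%N -> (i, j) <> (n, 0%N) ->
     ord (A' (eps n j%:Z) (eps n i%:Z))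
     = (j%:R / n%:R
        + (2 * n + 1)%:R * (alpha p n i j)%:Q / (n * p.-1)%:R)%:E).
Proof.
move=> A'.
have p_gt2 : (2 < p)%N by apply: leq_ltn_trans n_lt_p.
have n_gt0 : (0 < n)%N by apply: ltnW.
have q_gt1 : (1 < p ^ f)%N by rewrite -(exp1n f) ltn_exp2r // prime_gt1.
have [[tbar_Qq _] tbarX tbarE] := tbarP.
have tbar_neq0 : tbar != 0.
  have [_ _ _ red0 _] := redP; have Zq0 : Zq (p ^ f) (0 : C).
    by split; [exact: field_gen0|rewrite ord_0 leey].
  apply: contra t_neq0 => /eqP tbar0; rewrite -tbarE tbar0; apply/eqP/red0 => //.
  by rewrite ord_0 lt0y.
have ordA := ord_A p_prime p_gt2 n_gt0 gammaP gammatP q_gt1 sigmaP tbar_Qq tbarX tbar_neq0.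
have nQ0 : n%:R != 0 :> rat by rewrite pnatr_eq0 -lt0n.
have pE : p%:R = p.-1%:R + 1 :> rat by rewrite natr1 prednK // prime_gt0.
have p1Q0 : p.-1%:R != 0 :> rat by rewrite pnatr_eq0 -lt0n -subn1 subn_gt0 prime_gt1.
(* The case k0 = 0: then n (l0 + m0) = p h - i, and (p h - i)/(n(p-1)) + (i - h)/(n(p-1)) collapses
   to h/n. *)
have diag (i h l0 m0 : nat) : (i <= 2 * n)%N -> (h <= 2 * n)%N ->
    (l0 < p)%N -> (m0 < p)%N ->
    n%:Z * l0%:Z = p%:Z * (eps n h).1 - (eps n i).1 ->
    m0%:Z = p%:Z * (eps n h).2 - (eps n i).2 ->
    ord (A' (eps n h) (eps n i)) = (h%:R / n%:R)%:E.
  move=> i2n h2n l0p m0p e1 e2.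
  have on0 : on_line n (p%:Z * (eps n h).1 - (eps n i).1)
                       (p%:Z * (eps n h).2 - (eps n i).2) l0 m0 0.
    by rewrite /on_line -e1 -e2 !subr0 !eqxx.
  rewrite /A' (ordA _ _ _ _ _ on0) ?n_gt0 ?prime_gt0 // !nomega_eps //; congr (_%:E).
  have epsE k : (eps n k).1 + n%:Z * (eps n k).2 = k.
    by rewrite /eps; case: ifP => _ /=; ring.
  have : n%:Z * (l0%:Z + m0%:Z) = p%:Z * h%:Z - i%:Z.
    by rewrite mulrDr e1 e2 -[in RHS](epsE h) -[in RHS](epsE i); ring.
  move=> /(congr1 (fun x : int => x%:Q)).
  rewrite rmorphM rmorphB rmorphM rmorphD /= -!pmulrn pE => e.
  rewrite addn0 natrD rmorphB /= -!pmulrn natrM.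
  have -> : l0%:R + m0%:R = ((p.-1%:R + 1) * h%:R - i%:R) / n%:R :> rat.
    by rewrite -e mulrC mulKf.
  by field; rewrite p1Q0 nQ0.
have eps_le k : (k <= n)%N -> eps n k = (k%:Z, 0) by rewrite /eps lez_nat => ->.
have eps_gt k : (n < k)%N -> eps n k = (k%:Z - n%:Z, 1).
  by move=> nk; rewrite /eps lez_nat leqNgt nk.
have p_gt0 := prime_gt0 p_prime.
split=> [i i2n|i j i_n j_n ij].
- rewrite /g; case: ifPn => [|]; rewrite !inE.
    (* At the fixed points 0, n, 2n of g, the pair (l0, m0) is (0, 0), (p-1, 0) and (p-1, p-1). *)
    case/or3P=> /eqP i_eq; subst i.
    + by apply: (diag 0%N 0%N 0%N 0%N) => //; rewrite eps_le //= ?mulr0 subrr.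
    + have e : p%:Z = p.-1%:Z + 1 by rewrite -PoszD addn1 prednK.
      by apply: (diag n n p.-1 0%N); rewrite ?prednK ?eps_le //= e; ring.
    + have e : p%:Z = p.-1%:Z + 1 by rewrite -PoszD addn1 prednK.
      apply: (diag (2 * n)%N (2 * n)%N p.-1 p.-1); rewrite ?prednK //;
        by rewrite eps_gt ?ltn_Pmull //= e ?PoszM; ring.
  rewrite !negb_or -lt0n => /and3P[i_gt0 i_neq_n i_neq_2n].
  have i_lt : (0 < i < 2 * n)%N by rewrite i_gt0 ltn_neqAle i_neq_2n.
  have [r [l0 [/andP[r_gt0 r_lt] l0p -> l0E]]] :=
    g_coords n_gt1 n_lt_p varpiP i_lt i_neq_n.
  have r_le2n : (n + r <= 2 * n)%N by rewrite mul2n -addnn leq_add2l ltnW.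
  (* Both basis points share the second coordinate b, equal to 0 or 1, so m0 = p b - b is 0 or p -
     1. *)
  case: ltnP l0E => i_n l0E.
  + have [r_le_n i_le_n] := (ltnW r_lt, ltnW i_n).
    apply: (diag i r l0 0%N) => //; first exact: leq_trans (leq_addl _ _) r_le2n.
      by rewrite !eps_le //= l0E addr0.
    by rewrite !eps_le //= mulr0 subrr.
  + have n_lt_i : (n < i)%N by rewrite ltn_neqAle eq_sym i_neq_n.
    have n_lt_nr : (n < n + r)%N by rewrite -[X in (X < _)%N]addn0 ltn_add2l.
    rewrite -PoszD; apply: (diag i (n + r)%N l0 p.-1); rewrite ?prednK //.
      by rewrite !eps_gt //= l0E PoszD; ring.
    by rewrite !eps_gt //= mulr1 -subn1 subzn.
- have [l0 [k0 [l0p k0n lkE ->]]] := alpha_coords n_gt0 n_lt_p i_n j_n ij.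
  have j_le_n : (j <= n)%N by apply: leq_trans j_n (leq_pred n).
  have n_le2n : (n <= 2 * n)%N by rewrite leq_pmull.
  have i_le2n := leq_trans i_n n_le2n.
  have j_le2n := leq_trans j_le_n n_le2n.
  have k0p : (k0 < p)%N by apply: ltn_trans n_lt_p.
  (* Both second coordinates are 0, which forces m0 = k0. Then n (l0 + 2 k0) = p j - i + (2n+1) k0,
     whence the factor 2n+1. *)
  have on0 : on_line n (p%:Z * (eps n j).1 - (eps n i).1)
                       (p%:Z * (eps n j).2 - (eps n i).2) l0 k0 k0.
    by rewrite /on_line !eps_le //= lkE mulr0 subrr !eqxx.
  rewrite /A' (ordA _ _ _ _ _ on0) ?k0n // !nomega_eps //.
  congr (_%:E).
  have := congr1 (fun x : int => x%:Q) lkE.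
  rewrite !rmorphB !rmorphM /= -!pmulrn pE => e.
  have l0E : l0%:R = ((p.-1%:R + 1) * j%:R - i%:R + k0%:R) / n%:R :> rat.
    by rewrite -e; field.
  rewrite !natrD l0E.
  by field; rewrite p1Q0 nQ0.
Qed.
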